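(* Let $G$ be a group and $N$ a normal subgroup of $G$. Then the following hold. (1) For every $c\in\mathcal{C}_{\mathbb{Q}}(G,N)$, $$\mathrm{scl}_{G,N}(c)=\tfrac12\|c\|_{\mathrm h}.$$ (2) The function $\mathrm{scl}_{G,N}:\mathcal{C}^{\mathrm h}_{\mathbb{Q}}(G,N)\to\mathbb{R}_{\ge0}$ admits a unique continuous extension $\mathrm{scl}_{G,N}:\mathcal{C}^{\mathrm h}(G,N)\to\mathbb{R}_{\ge0}$. Furthermore, the map $$\bigl(\mathrm{Q}(N)^G/\mathrm{H}^1(N)^G,2D_N\bigr)\times\bigl(\mathcal{C}^{\mathrm h}(G,N),\mathrm{scl}_{G,N}\bigr)\to\mathbb{R},\qquad([\mu],c)\mapsto\mu(c),$$ is the duality pairing for $(\mathcal{C}^{\mathrm h}(G,N),\mathrm{scl}_{G,N})$. In particular, the continuous dual $(\mathcal{C}^{\mathrm h}(G,N),\mathrm{scl}_{G,N})^*$ is isometrically isomorphic to $(\mathrm{Q}(N)^G/\mathrm{H}^1(N)^G,2D_N)$.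
   Context: Quasimorphisms: for a group $H$ and $f:H\to\mathbb{R}$, the defect is $D_H(f)=\sup\{|f(h_1h_2)-f(h_1)-f(h_2)| : h_1,h_2\in H\}$; $f$ is a quasimorphism if $D_H(f)<\infty$, and homogeneous if its restriction to every cyclic subgroup is a homomorphism. $\mathrm{Q}(H)$ is the real vector space of homogeneous quasimorphisms on $H$, $\mathrm{H}^1(H)=\mathrm{Hom}(H,\mathbb{R})$. $\mathrm{Q}(N)^G$, $\mathrm{H}^1(N)^G$ are the subspaces of elements of $\mathrm{Q}(N)$, $\mathrm{H}^1(N)$ invariant under conjugation by $G$. $D_N$ induces a norm on $\mathrm{Q}(N)^G/\mathrm{H}^1(N)^G$. Chains: for $R\in\{\mathbb{Z},\mathbb{Q},\mathbb{R}\}$, $\mathrm{C}_k(G;R)$ is the free $R$-module on $G^k$, and $\partial:\mathrm{C}_2(G;R)\to\mathrm{C}_1(G;R)$ is $\partial(g_1,g_2)=g_2-g_1g_2+g_1$. $\mathrm{C}_2'(G,N;R)$ is the submodule generated by those $(g_1,g_2)$ with $g_1\in N$ or $g_2\in N$. Put $\mathrm{B}_1'(G,N;R)=\partial\mathrm{C}'_2(G,N;R)$ and $\mathcal{C}_R(G,N)=\mathrm{C}_1(N;R)\cap\mathrm{B}'_1(G,N;R)$. Functions on $N$ are evaluated on chains by linear extension. On $\mathrm{B}'_1(G,N;\mathbb{R})$, and hence on $\mathcal{C}_{\mathbb{R}}(G,N)$, use the norm $\|c\|'=\inf\{\|c'\|_1 : c'\in\mathrm{C}'_2(G,N;\mathbb{R}),\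 \partial c'=c\}$, with $\|\cdot\|_1$ the $\ell^1$-norm. Let $\mathrm{h}(G,N)\subseteq\mathcal{C}_{\mathbb{R}}(G,N)$ be the real span of $\{x^k-kx : x\in N,k\in\mathbb{Z}\}$, and $\mathcal{C}^{\mathrm h}(G,N)=\mathcal{C}_{\mathbb{R}}(G,N)/\overline{\mathrm{h}(G,N)}^{\|\cdot\|'}$ (quotient by the norm closure), with quotient norm $\|\cdot\|_{\mathrm h}$. $\mathcal{C}^{\mathrm h}_{\mathbb{Q}}(G,N)$ is the image of $\mathcal{C}_{\mathbb{Q}}(G,N)$ in $\mathcal{C}^{\mathrm h}(G,N)$. The class of $c\in\mathcal{C}_{\mathbb{R}}(G,N)$ is also written $c$. For $\mu\in\mathrm{Q}(N)^G$, $\mu(c)$ depends only on the class of $c$ in $\mathcal{C}^{\mathrm h}(G,N)$ and, for such $c$, only on $[\mu]$. By (1), $\mathrm{scl}_{G,N}$ on $\mathcal{C}_{\mathbb Q}(G,N)$ descends to $\mathcal{C}^{\mathrm h}_{\mathbb{Q}}(G,N)$; continuity in (2) is with respect to $\|\cdot\|_{\mathrm h}$. Mixed scl on chains: for $y\in[G,N]$ (the subgroup generated by all $[g,x]=gxg^{-1}x^{-1}$, $g\in G$, $x\in N$), $\mathrm{cl}_{G,N}(y)$ is the minimal number of such commutators whose product is $y$. An element of $\mathcal{C}_{\mathbb{Z}}(G,N)$ is expressed as $c=x_1+\dots+x_m-\check x_1-\dots-\check x_n$ with $x_i,\check x_j\in N$; for such an expression set $\mathrm{cl}_{G,N}(c)=\inf\mathrm{cl}_{G,N}(\xi_1\cdots\xi_m\eta_1^{-1}\cdots\eta_n^{-1})$,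 where $\xi_i$ runs over the $G$-conjugates of $x_i$ and $\eta_j$ over the $G$-conjugates of $\check x_j$. Then $\mathrm{scl}_{G,N}(c)=\lim_{k\to\infty}\frac1k\mathrm{cl}_{G,N}(x_1^k+\dots+x_m^k-\check x_1^k-\dots-\check x_n^k)$. For $c\in\mathcal{C}_{\mathbb{Q}}(G,N)$, $\mathrm{scl}_{G,N}(c)=\mathrm{scl}_{G,N}(kc)/k$ for any $k\in\mathbb{N}$ with $kc\in\mathcal{C}_{\mathbb{Z}}(G,N)$. It is known that this is well-defined. Duality pairing: for real normed spaces $X,Y$, a bilinear form $\langle\cdot,\cdot\rangle:Y\times X\to\mathbb{R}$ is called the duality pairing for $X$ if $y\mapsto\langle y,\cdot\rangle$ is a surjective isometry from $Y$ onto the continuous dual $X^*$ with its dual norm. *)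

(* Defs.v *)
From HB Require Import structures.
From mathcomp Require Import all_boot all_order all_algebra.
From mathcomp Require Import freeg.
From mathcomp Require Import all_classical all_reals all_analysis.
From mathcomp Require Import ring.
Set Implicit Arguments.
Unset Strict Implicit.
Unset Printing Implicit Defensive.
Import Order.TTheory GRing.Theory Num.Theory.
Import numFieldNormedType.Exports.
Local Open Scope classical_set_scope.
Local Open Scope ring_scope.

Section QuotientModule.
Local Open Scope quotient_scope.
Variables (K : nzRingType) (V : lmodType K) (S : submodClosed V).

(* The same set [S], packed as an additive subgroup: the library does not infer
   [zmodClosed] from [submodClosed]. *)
Definition subgroup_of : {pred V} := fun v => v \in S.
Lemma subgroup_of_closed : GRing.zmod_closed subgroup_of.
Proof.
split=> [|u v Su Sv]; first exact: (rpred0 S).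
by apply: (@rpredD _ S) => //; rewrite -scaleN1r; apply: (@rpredZ _ _ S).
Qed.
HB.instance Definition _ := GRing.isZmodClosed.Build V subgroup_of
  subgroup_of_closed.

Definition quotmod : Type := Quotient.quot subgroup_of.
HB.instance Definition _ := GRing.Zmodule.on quotmod.

Definition quotpi (v : V) : quotmod := \pi_(Quotient.quot subgroup_of) v.
Definition quotrep (q : quotmod) : V := repr (q : Quotient.quot subgroup_of).

Lemma quotrepK : cancel quotrep quotpi. Proof. by move=> q; exact: reprK. Qed.

Lemma quotpi_eqP u v : quotpi u = quotpi v <-> u - v \in S.
Proof.
rewrite -[u - v \in S]/(Quotient.equiv subgroup_of u v).
by split=> [/eqP|h]; [|apply/eqP]; rewrite /quotpi ?piE // => ->.
Qed.

Lemma quotpiD u v : quotpi (u + v) = quotpi u + quotpi v.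
Proof. by rewrite /quotpi raddfD. Qed.

Lemma quotrep_pi v : quotrep (quotpi v) - v \in S.
Proof. by apply/quotpi_eqP; rewrite quotrepK. Qed.

Definition quotscale (a : K) (q : quotmod) : quotmod := quotpi (a *: quotrep q).

Lemma quotscale_pi a v : quotscale a (quotpi v) = quotpi (a *: v).
Proof. by apply/quotpi_eqP; rewrite -scalerBr rpredZ // quotrep_pi. Qed.

Lemma quotscaleA a b q : quotscale a (quotscale b q) = quotscale (a * b) q.
Proof. by rewrite {2}/quotscale quotscale_pi scalerA. Qed.
Lemma quotscale1 : left_id 1 quotscale.
Proof. by move=> q; rewrite /quotscale scale1r quotrepK. Qed.
Lemma quotscaleDr : right_distributive quotscale +%R.
Proof.
move=> a p q; rewrite -[p]quotrepK -[q]quotrepK -quotpiD !quotscale_pi.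
by rewrite scalerDr quotpiD.
Qed.
Lemma quotscaleDl q : {morph quotscale^~ q : a b / a + b}.
Proof. by move=> a b; rewrite /quotscale scalerDl quotpiD. Qed.

HB.instance Definition _ := GRing.Zmodule_isLmodule.Build K quotmod
  quotscaleA quotscale1 quotscaleDr quotscaleDl.

Lemma quotpi_is_linear : linear quotpi.
Proof.
by move=> a u v; rewrite quotpiD -[a *: quotpi u]/(quotscale _ _) quotscale_pi.
Qed.
HB.instance Definition _ := GRing.isLinear.Build K V quotmod *:%R quotpi
  quotpi_is_linear.

End QuotientModule.

Section Span.
Variables (K : nzRingType) (V : lmodType K).

Definition lspan (A : set V) : set V :=
  [set v | exists2 s : seq (K * V),
     {in s, forall p, A p.2} & v = \sum_(p <- s) p.1 *: p.2].

Lemma lspan_linear A (a : K) u v :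
  lspan A u -> lspan A v -> lspan A (a *: u + v).
Proof.
move=> [s As ->] [t At ->]; exists ([seq (a * p.1, p.2) | p <- s] ++ t).
  by move=> p; rewrite mem_cat => /orP[/mapP[q /As Aq ->]|/At].
rewrite big_cat big_map scaler_sumr; congr (_ + _).
by apply: eq_bigr => p _; rewrite scalerA.
Qed.

Lemma lspan0 A : lspan A 0.
Proof. by exists [::]; rewrite ?big_nil. Qed.

Lemma sub_lspan A : A `<=` lspan A.
Proof.
move=> v Av; exists [:: (1, v)]; last by rewrite big_seq1 scale1r.
by move=> p; rewrite inE => /eqP ->.
Qed.

End Span.

Record norm_on (R : realType) (V : lmodType R) := NormOn {
  norm_fun :> V -> R;
  norm_onD : forall u v, norm_fun (u + v) <= norm_fun u + norm_fun v;
  norm_onZ : forall a v, norm_fun (a *: v) = `|a| * norm_fun v;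
  norm_on0 : forall v, norm_fun v = 0 -> v = 0 }.

Definition normed_by (R : realType) (V : lmodType R) (p : norm_on V) : Type := V.
HB.instance Definition _ (R : realType) (V : lmodType R) (p : norm_on V) :=
  GRing.Lmodule.on (normed_by p).
HB.instance Definition _ (R : realType) (V : lmodType R) (p : norm_on V) :=
  Lmodule_isNormed.Build R (normed_by p)
    (@norm_onD R V p) (@norm_onZ R V p) (@norm_on0 R V p).

Section QuotientNorm.
Variables (R : realType) (V : normedModType R) (S : submodClosed V).

Definition closurep : {pred V} := fun v => `[< closure [set` S] v >].

Lemma closurepP v :
  reflect (forall e, 0 < e -> exists2 w, w \in S & `|v - w| < e)
          (v \in closurep).
Proof.
apply: (iffP (asboolP _)) => [cv e e0|H B].
  have [w [Sw vw]] := cv _ (nbhsx_ballx v e e0).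
  by exists w => //; move: vw; rewrite -ball_normE.
move=> /nbhs_ballP[e /= e0 eB]; have [w Sw vw] := H e e0.
by exists w; split=> //; apply: eB; rewrite -ball_normE.
Qed.

Lemma closurep_submod : GRing.submod_closed closurep.
Proof.
split=> [|a u v /closurepP cu /closurepP cv].
  by apply/closurepP => e e0; exists 0; rewrite ?rpred0// subrr normr0.
apply/closurepP => e e0.
have a1 : 0 < `|a| + 1 by rewrite ltr_wpDl.
have [w Sw uw] := cu (e / 2 / (`|a| + 1)) ltac:(by rewrite !divr_gt0).
have [z Sz vz] := cv (e / 2) ltac:(by rewrite divr_gt0).
exists (a *: w + z); first by rewrite rpredD ?rpredZ.
rewrite opprD addrACA -scalerBr (le_lt_trans (ler_normD _ _))//.
rewrite [e]splitr ltr_leD ?(ltW vz)// normrZ.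
rewrite (@le_lt_trans _ _ ((`|a| + 1) * `|u - w|)) ?ler_wpM2r ?lerDl//.
by rewrite mulrC -ltr_pdivlMr.
Qed.

HB.instance Definition _ := GRing.isSubmodClosed.Build R V closurep
  closurep_submod.

Definition quot_closure : Type := quotmod closurep.
HB.instance Definition _ := GRing.Lmodule.on quot_closure.

Definition qnorm (q : quot_closure) : R :=
  inf [set `|v| | v in [set v | quotpi closurep v = q]].

Lemma qnorm_has_inf (q : quot_closure) :
  has_inf [set `|v| | v in [set v | quotpi closurep v = q]].
Proof.
split; first by exists `|quotrep q|, (quotrep q) => //=; rewrite quotrepK.
by exists 0 => _ [v _ <-].
Qed.

Lemma qnorm_le v : qnorm (quotpi closurep v) <= `|v|.
Proof. by apply: (ge_inf (qnorm_has_inf _).2); exists v. Qed.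

Lemma qnorm_ge0 q : 0 <= qnorm q.
Proof. by apply: lb_le_inf; [exact: (qnorm_has_inf q).1|move=> _ [v _ <-]]. Qed.

Lemma qnorm_approx (q : quot_closure) e : 0 < e ->
  exists2 v, quotpi closurep v = q & `|v| < qnorm q + e.
Proof.
by move=> e0; have [_ [v vq <-] ve] := inf_adherent e0 (qnorm_has_inf q); exists v.
Qed.

Lemma qnormD p q : qnorm (p + q) <= qnorm p + qnorm q.
Proof.
apply/ler_addgt0Pr => e e0; have e2 : 0 < e / 2 by rewrite divr_gt0.
have [u <- ue] := qnorm_approx p e2; have [v <- ve] := qnorm_approx q e2.
rewrite -linearD (le_trans (qnorm_le _))// (le_trans (ler_normD _ _))//.
by rewrite [e in leRHS]splitr addrACA lerD// ltW.
Qed.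

Lemma qnormZ_le a q : qnorm (a *: q) <= `|a| * qnorm q.
Proof.
apply/ler_addgt0Pr => e e0; have a1 : 0 < `|a| + 1 by rewrite ltr_wpDl.
have [u uq ue] := qnorm_approx q (divr_gt0 e0 a1).
rewrite -{1}uq -linearZ (le_trans (qnorm_le _))// normrZ.
rewrite (le_trans (ler_wpM2l (normr_ge0 a) (ltW ue)))// mulrDr lerD2l.
by rewrite mulrCA ler_piMr ?ltW// ltr_pdivrMr// mul1r ltrDl.
Qed.

Lemma qnormZ a q : qnorm (a *: q) = `|a| * qnorm q.
Proof.
apply/eqP; rewrite eq_le qnormZ_le /=; have [->|a0] := eqVneq a 0.
  by rewrite normr0 mul0r qnorm_ge0.
have := qnormZ_le a^-1 (a *: q); rewrite scalerA mulVf// scale1r normfV.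
by rewrite ler_pdivlMl ?normr_gt0.
Qed.

Lemma qnorm0_eq0 q : qnorm q = 0 -> q = 0.
Proof.
move=> q0; rewrite -[q]quotrepK -(linear0 (quotpi closurep)).
apply/quotpi_eqP; rewrite subr0; apply/closurepP => e e0.
have [u uq ue] := qnorm_approx q (divr_gt0 e0 (ltr0n R 2)).
have /quotpi_eqP/closurepP : quotpi closurep (quotrep q) = quotpi closurep u.
  by rewrite quotrepK.
move=> /(_ _ (divr_gt0 e0 (ltr0n R 2)))[w Sw]; rewrite -addrA -opprD => we.
exists w => //; have -> : quotrep q - w = quotrep q - (u + w) + u.
  by rewrite opprD addrA addrAC subrK.
rewrite (le_lt_trans (ler_normD _ _))// [e]splitr ltrD//.
by move: ue; rewrite q0 add0r.
Qed.

HB.instance Definition _ := Lmodule_isNormed.Build R quot_closure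
  qnormD qnormZ qnorm0_eq0.

End QuotientNorm.

Section Dual.
Variables (R : realType) (X : normedModType R).

Definition dual_pred : {pred X -> R^o} :=
  fun f => `[< linear f /\ continuous f >].

Lemma dual_pred_submod : GRing.submod_closed dual_pred.
Proof.
split=> [|a f g /asboolP[lf cf] /asboolP[lg cg]]; apply/asboolP; split.
- by move=> b u v; rewrite /= scaler0 addr0.
- by move=> x; exact: cst_continuous.
- move=> b u v; rewrite !fctE lf lg.
  by rewrite !scalerDr addrACA !scalerA [a * b]mulrC.
- by move=> x; apply: continuousD (cg x); apply: continuousZl_tmp (cf x).
Qed.
HB.instance Definition _ := GRing.isSubmodClosed.Build R (X -> R^o) dual_pred
  dual_pred_submod.

Definition dual : Type := {f : X -> R^o | f \in dual_pred}.
HB.instance Definition _ := [isSub of dual for @sval _ _].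
HB.instance Definition _ := [Choice of dual by <:].
HB.instance Definition _ := [SubChoice_isSubLmodule of dual by <:].

Definition dual_fun (f : dual) : X -> R^o := val f.
Coercion dual_fun : dual >-> Funclass.

Definition dual_norm (f : dual) : R :=
  sup [set `|f x| | x in [set x | `|x| <= 1]].

Lemma dual_linear (f : dual) : linear f.
Proof. by have /asboolP[] := valP f. Qed.
Lemma dual_continuous (f : dual) : continuous f.
Proof. by have /asboolP[] := valP f. Qed.
HB.instance Definition _ (f : dual) :=
  GRing.isLinear.Build R X R^o *:%R (dual_fun f) (dual_linear f).

Lemma dual_norm_has_sup (f : dual) :
  has_sup [set `|f x| | x in [set x : X | `|x| <= 1]].
Proof.
split; first by exists `|f 0|, 0 => //=; rewrite normr0.
have cf : {for 0, continuous f} by exact: dual_continuous.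
have /linear_boundedP :=
  @continuous_linear_bounded R X R^o 0 (dual_fun f) cf.
move=> /pinfty_ex_gt0[M M0 fM]; exists M => _ [x /= x1 <-].
by rewrite (le_trans (fM x))// ler_piMr// ltW.
Qed.

Lemma dual_norm_ub (f : dual) x : `|x| <= 1 -> `|f x| <= dual_norm f.
Proof. by move=> x1; apply: (ub_le_sup (dual_norm_has_sup f).2); exists x. Qed.

Lemma dual_norm_ge0 f : 0 <= dual_norm f.
Proof. by rewrite (le_trans _ (@dual_norm_ub f 0 _))// normr0. Qed.

Lemma dual_normD f g : dual_norm (f + g) <= dual_norm f + dual_norm g.
Proof.
apply: ge_sup; first exact: (dual_norm_has_sup _).1.
move=> _ [x /= x1 <-]; rewrite (le_trans (ler_normD _ _))//.
by rewrite lerD// dual_norm_ub.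
Qed.

Lemma dual_normZ_le a f : dual_norm (a *: f) <= `|a| * dual_norm f.
Proof.
apply: ge_sup; first exact: (dual_norm_has_sup _).1.
by move=> _ [x /= x1 <-]; rewrite normrZ ler_wpM2l// dual_norm_ub.
Qed.

Lemma dual_normZ a f : dual_norm (a *: f) = `|a| * dual_norm f.
Proof.
apply/eqP; rewrite eq_le dual_normZ_le /=; have [->|a0] := eqVneq a 0.
  by rewrite normr0 mul0r dual_norm_ge0.
have := dual_normZ_le a^-1 (a *: f); rewrite scalerA mulVf// scale1r normfV.
by rewrite ler_pdivlMl ?normr_gt0.
Qed.

Lemma dual_norm0_eq0 f : dual_norm f = 0 -> f = 0.
Proof.
move=> f0; apply/val_inj/funext => x /=; have [->|x0] := eqVneq x 0.
  exact: (linear0 (dual_fun f)).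
have := @dual_norm_ub f (`|x|^-1 *: x); rewrite f0 normrZ normfV normr_id.
rewrite mulVf ?normr_eq0// => /(_ (lexx _)).
rewrite normr_le0 linearZ scaler_eq0 invr_eq0 normr_eq0 (negbTE x0).
by move=> /eqP.
Qed.

HB.instance Definition _ := Lmodule_isNormed.Build R dual
  dual_normD dual_normZ dual_norm0_eq0.

End Dual.

Section DualityPairing.
Variable R : realType.

Definition isometrically_isomorphic (V W : normedModType R) :=
  exists2 T : {linear V -> W}, bijective T & forall v, `|T v| = `|v|.

(* A linear [T : Y -> X^*] with [T y = B y] makes [B] bilinear and continuous
   in its second argument. *)
Definition is_duality_pairing (Y X : normedModType R) (B : Y -> X -> R) :=
  exists T : {linear Y -> dual X},
    [/\ forall y x, dual_fun (T y) x = B y x,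
        forall y, `|T y| = `|y|
      & forall f, exists y, T y = f].

End DualityPairing.

Section GroupNotions.
Local Open Scope group_scope.

Definition zpow (G : groupType) (x : G) (k : int) : G :=
  match k with Posz n => x ^+ n | Negz n => x ^- n.+1 end.

(* The library's [x ^ g] and [[~ g, x]] are g^-1 x g and g^-1 x^-1 g x. *)
Definition conjL (G : groupType) (g x : G) : G := g * x * g^-1.
Definition commL (G : groupType) (g x : G) : G := g * x * g^-1 * x^-1.

Definition is_normal (G : groupType) (N : groupClosed G) :=
  forall g x : G, x \in N -> conjL g x \in N.

Definition subgrp (G : groupType) (N : groupClosed G) : Type :=
  {x : G | x \in N}.

End GroupNotions.

Section Subgroup.
Variables (G : groupType) (N : groupClosed G).

HB.instance Definition _ := [isSub of subgrp N for @sval _ _].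
HB.instance Definition _ := [Choice of subgrp N by <:].
Lemma subgrp_closed : group_closed (fun x : G => x \in N).
Proof.
split=> [|x y xN yN]; first exact: (gpred1 (s := N)).
exact: (@gpredF _ N).
Qed.
HB.instance Definition _ :=
  SubChoice_isSubGroup.Build G (fun x : G => x \in N) (subgrp N) subgrp_closed.
Definition subgrp_incl (x : subgrp N) : G := val x.
End Subgroup.

Section FreeModule.
Variables (K : nzRingType) (T : choiceType).
Implicit Types c d : {freeg T / K}.

Lemma fglift_is_linear (M : lmodType K) (f : T -> M) : linear (fglift f).
Proof.
pose F : {additive {freeg T / K} -> M} :=
  HB.pack (fglift f) (GRing.isZmodMorphism.Build _ _ _ (lift_is_additive f)).
have FE c : F c = \sum_(x <- dom c) coeff x c *: f x.
  by rewrite -{1}[c]freeg_sumE raddf_sum; apply: eq_bigr => x _; exact: liftU.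
move=> a c d; rewrite -[LHS]/(F _) -[RHS]/(a *: F c + F d) raddfD; congr (_ + _).
rewrite -{1}[c]freeg_sumE scaler_sumr raddf_sum FE scaler_sumr.
apply: eq_bigr => x _; rewrite scalerA -(liftU f); congr fglift.
by apply/eqP/freeg_eqP => y; rewrite coeffZ !coeffU mulrA.
Qed.
HB.instance Definition _ (M : lmodType K) (f : T -> M) :=
  GRing.isLinear.Build K {freeg T / K} M *:%R (fglift f) (fglift_is_linear f).

End FreeModule.

Section ChangeOfCoefficients.
Variables (K L : nzRingType) (f : {rmorphism K -> L}) (T : choiceType).

Definition fgchange (c : {freeg T / K}) : {freeg T / L} :=
  \sum_(x <- dom c) << f (coeff x c) *g x >>.

Lemma coeff_fgchange x c : coeff x (fgchange c) = f (coeff x c).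
Proof.
rewrite -{2}[c]freeg_sumE !raddf_sum /=; apply: eq_bigr => y _.
by rewrite !coeffU rmorphM rmorph_nat.
Qed.

Lemma fgchangeD c d : fgchange (c + d) = fgchange c + fgchange d.
Proof.
by apply/eqP/freeg_eqP => x; rewrite !(coeffD, coeff_fgchange) rmorphD.
Qed.
Lemma fgchangeZ a c : fgchange (a *: c) = f a *: fgchange c.
Proof.
by apply/eqP/freeg_eqP => x; rewrite !(coeffZ, coeff_fgchange) rmorphM.
Qed.
Lemma fgchangeU x : fgchange << x >> = << x >>.
Proof.
by apply/eqP/freeg_eqP => y; rewrite coeff_fgchange !coeffU rmorphM rmorph1 rmorph_nat.
Qed.
Lemma fgchange0 : fgchange 0 = 0.
Proof. by apply/eqP/freeg_eqP => y; rewrite coeff_fgchange !coeff0 rmorph0. Qed.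
Lemma fgchange_sum I (r : seq I) (F : I -> {freeg T / K}) :
  fgchange (\sum_(i <- r) F i) = \sum_(i <- r) fgchange (F i).
Proof. exact: (big_morph _ fgchangeD fgchange0). Qed.

End ChangeOfCoefficients.

Lemma fgchange_fglift (K L : nzRingType) (f : {rmorphism K -> L})
    (S T : choiceType) (F : S -> {freeg T / K}) (F' : S -> {freeg T / L}) c :
  (forall s, fgchange f (F s) = F' s) ->
  fgchange f (fglift F c) = fglift F' (fgchange f c).
Proof.
move=> FF'; rewrite -{1}[c]freeg_sumE [fgchange f c in RHS]/fgchange !raddf_sum /=.
rewrite fgchange_sum.
by apply: eq_bigr => s _; rewrite !liftU fgchangeZ FF'.
Qed.

Section L1Norm.
Variables (R : realType) (T : choiceType).
Implicit Types c d : {freeg T / R}.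

Definition l1norm c : R := \sum_(x <- dom c) `|coeff x c|.

Lemma l1norm_ge0 c : 0 <= l1norm c.
Proof. exact: sumr_ge0. Qed.

Lemma l1normE (s : seq T) c : uniq s -> {subset dom c <= s} ->
  l1norm c = \sum_(x <- s) `|coeff x c|.
Proof.
move=> us cs; rewrite (bigID [in dom c])/= [X in _ + X]big1 => [|x xc].
  rewrite addr0 -big_filter; apply: perm_big; apply: uniq_perm.
  - exact: uniq_dom.
  - exact: filter_uniq.
  - by move=> x; rewrite mem_filter; case: (boolP (x \in dom c)) => [/cs ->|].
by rewrite coeff_outdom ?normr0.
Qed.

Lemma l1normD c d : l1norm (c + d) <= l1norm c + l1norm d.
Proof.
set s := undup (dom c ++ dom d).
have cs : {subset dom c <= s} by move=> x xc; rewrite mem_undup mem_cat xc.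
have ds : {subset dom d <= s} by move=> x xd; rewrite mem_undup mem_cat xd orbT.
have cds : {subset dom (c + d) <= s}.
  by move=> x /domD_subset; rewrite mem_undup.
rewrite !(@l1normE s) ?undup_uniq// -big_split; apply: ler_sum => x _.
by rewrite coeffD ler_normD.
Qed.

Lemma l1normZ a c : l1norm (a *: c) = `|a| * l1norm c.
Proof.
rewrite (@l1normE (dom c)) ?uniq_dom//; last exact: domZ_subset.
by rewrite mulr_sumr; apply: eq_bigr => x _; rewrite coeffZ normrM.
Qed.

Lemma l1norm0 : l1norm 0 = 0. Proof. by rewrite -(scale0r 0) l1normZ normr0 mul0r. Qed.

Lemma l1normU x : l1norm << x >> = 1.
Proof. by rewrite /l1norm domU1 big_seq1 coeffU eqxx mulr1 normr1. Qed.

Lemma l1norm0_eq0 c : l1norm c = 0 -> c = 0.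
Proof.
move=> /eqP; rewrite psumr_eq0// => /allP c0; apply/eqP/freeg_eqP => x.
rewrite coeff0; have [xc|/coeff_outdom//] := boolP (x \in dom c).
by apply/eqP; rewrite -normr_eq0; exact: c0.
Qed.

End L1Norm.

Lemma l1norm_fglift (R : realType) (S T : choiceType) (F : S -> {freeg T / R})
    M c :
  (forall x, l1norm (F x) <= M) -> l1norm (fglift F c) <= M * l1norm c.
Proof.
move=> FM; rewrite -{1}[c]freeg_sumE raddf_sum /= mulr_sumr.
elim/big_ind2: _ => [|x u y v xu yv|x _]; first by rewrite l1norm0.
  by rewrite (le_trans (l1normD _ _))// lerD.
by rewrite liftU l1normZ mulrC ler_wpM2r.
Qed.

Section MixedChains.
Variables (G : groupType) (N : groupClosed G) (K : nzRingType).

Definition bd : {freeg (G * G)%type / K} -> {freeg G / K} :=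
  fglift (fun g : G * G => << g.2 >> - << (g.1 * g.2)%g >> + << g.1 >>).
HB.instance Definition _ := GRing.Linear.on bd.

Definition C2' : set {freeg (G * G)%type / K} :=
  lspan [set << g >> | g in [set g : G * G | g.1 \in N \/ g.2 \in N]].

Definition B1' : set {freeg G / K} := bd @` C2'.

Definition chain_incl : {freeg (subgrp N) / K} -> {freeg G / K} :=
  fglift (fun x => << subgrp_incl x >>).
HB.instance Definition _ := GRing.Linear.on chain_incl.

(* C_1(N; K) `&` B_1'(G, N; K), with C_1(N; K) kept as the free module on [N]. *)
Definition mixed_pred : {pred {freeg (subgrp N) / K}} :=
  fun c => `[< B1' (chain_incl c) >].

Lemma mixed_pred_submod : GRing.submod_closed mixed_pred.
Proof.
split=> [|a c d /asboolP[c' Cc cc] /asboolP[d' Cd dd]]; apply/asboolP.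
  by exists 0; [exact: lspan0|rewrite !linear0].
by exists (a *: c' + d'); [exact: lspan_linear|rewrite !linearP /= cc dd].
Qed.
HB.instance Definition _ :=
  GRing.isSubmodClosed.Build K {freeg (subgrp N) / K} mixed_pred
    mixed_pred_submod.

Definition mixed_chain : Type :=
  {c : {freeg (subgrp N) / K} | c \in mixed_pred}.
HB.instance Definition _ := [isSub of mixed_chain for @sval _ _].
HB.instance Definition _ := [Choice of mixed_chain by <:].
HB.instance Definition _ := [SubChoice_isSubLmodule of mixed_chain by <:].

Lemma coeff_chain_incl (x : subgrp N) c :
  coeff (subgrp_incl x) (chain_incl c) = coeff x c.
Proof.
rewrite -{2}[c]freeg_sumE -{1}[c]freeg_sumE !raddf_sum.
by apply: eq_bigr => y _; rewrite /= /chain_incl liftU coeffZ !coeffU mul1r.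
Qed.

Lemma chain_incl_inj : injective chain_incl.
Proof.
move=> c d cd; apply/eqP/freeg_eqP => x.
by rewrite -!coeff_chain_incl cd.
Qed.

End MixedChains.
Arguments C2' {G} N K _.
Arguments B1' {G} N K _.
Arguments mixed_pred {G} N K _.

Lemma mixed_pred_change (G : groupType) (N : groupClosed G) (K L : nzRingType)
    (f : {rmorphism K -> L}) (c : {freeg (subgrp N) / K}) :
  c \in mixed_pred N K -> fgchange f c \in mixed_pred N L.
Proof.
move=> /asboolP[c' [s sC c'E] bdc]; apply/asboolP; exists (fgchange f c').
  exists [seq (f p.1, fgchange f p.2) | p <- s].
    by move=> p /mapP[q /sC[g gN qg] ->]; exists g; rewrite //= -qg fgchangeU.
  rewrite c'E fgchange_sum big_map; apply: eq_bigr => p _.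
  by rewrite fgchangeZ.
transitivity (fgchange f (bd c')).
  apply/esym/fgchange_fglift => g.
  rewrite !fgchangeD !fgchangeU -scaleN1r fgchangeZ fgchangeU rmorphN1.
  by rewrite scaleN1r.
by rewrite bdc; apply: fgchange_fglift => x; rewrite fgchangeU.
Qed.

Definition mixed_change (G : groupType) (N : groupClosed G) (K L : nzRingType)
    (f : {rmorphism K -> L}) (c : mixed_chain N K) : mixed_chain N L :=
  Sub (fgchange f (val c)) (mixed_pred_change f (valP c)).

Section FillingNorm.
Variables (R : realType) (G : groupType) (N : groupClosed G).

Definition fillings (b : {freeg G / R}) : set {freeg (G * G)%type / R} :=
  [set c' | C2' N R c' /\ bd c' = b].

Definition filling_norm (b : {freeg G / R}) : R :=
  inf [set l1norm c' | c' in fillings b].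

Definition mixed_norm (c : mixed_chain N R) : R :=
  filling_norm (chain_incl (val c)).

Lemma mixed_norm_has_inf (c : mixed_chain N R) :
  has_inf [set l1norm c' | c' in fillings (chain_incl (val c))].
Proof.
split.
  by have /asboolP[c' Cc bc] := valP c; exists (l1norm c'), c'.
by exists 0 => _ [c' _ <-]; exact: l1norm_ge0.
Qed.

Lemma mixed_norm_le (c : mixed_chain N R) c' :
  fillings (chain_incl (val c)) c' -> mixed_norm c <= l1norm c'.
Proof. by move=> h; apply: (ge_inf (mixed_norm_has_inf c).2); exists c'. Qed.

Lemma mixed_norm_approx (c : mixed_chain N R) e : 0 < e ->
  exists2 c', fillings (chain_incl (val c)) c' & l1norm c' < mixed_norm c + e.
Proof.
move=> e0; have [_ [c' cc <-] h] := inf_adherent e0 (mixed_norm_has_inf c).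
by exists c'.
Qed.

Lemma mixed_norm_ge0 c : 0 <= mixed_norm c.
Proof.
apply: lb_le_inf; first exact: (mixed_norm_has_inf c).1.
by move=> _ [c' _ <-]; exact: l1norm_ge0.
Qed.

Lemma mixed_normD c d : mixed_norm (c + d) <= mixed_norm c + mixed_norm d.
Proof.
apply/ler_addgt0Pr => e e0; have e2 : 0 < e / 2 by rewrite divr_gt0.
have [u [Cu bu] ue] := mixed_norm_approx c e2.
have [v [Cv bv] ve] := mixed_norm_approx d e2.
rewrite (@le_trans _ _ (l1norm (u + v)))//; last first.
  rewrite (le_trans (l1normD _ _))//.
  by rewrite [e in leRHS]splitr addrACA lerD// ltW.
apply: mixed_norm_le; split; last by rewrite !linearD /= bu bv.
by rewrite -[u]scale1r; exact: lspan_linear.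
Qed.

Lemma mixed_normZ_le a c : mixed_norm (a *: c) <= `|a| * mixed_norm c.
Proof.
apply/ler_addgt0Pr => e e0; have a1 : 0 < `|a| + 1 by rewrite ltr_wpDl.
have [u [Cu bu] ue] := mixed_norm_approx c (divr_gt0 e0 a1).
rewrite (@le_trans _ _ (l1norm (a *: u)))//.
  apply: mixed_norm_le; split; last by rewrite !linearZ /= bu.
  by rewrite -[_ *: _]addr0; apply: lspan_linear => //; exact: lspan0.
rewrite l1normZ (le_trans (ler_wpM2l (normr_ge0 a) (ltW ue)))//.
rewrite mulrDr lerD2l.
by rewrite mulrCA ler_piMr ?ltW// ltr_pdivrMr// mul1r ltrDl.
Qed.

Lemma mixed_normZ a c : mixed_norm (a *: c) = `|a| * mixed_norm c.
Proof.
apply/eqP; rewrite eq_le mixed_normZ_le /=; have [->|a0] := eqVneq a 0.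
  by rewrite normr0 mul0r mixed_norm_ge0.
have := mixed_normZ_le a^-1 (a *: c); rewrite scalerA mulVf// scale1r normfV.
by rewrite ler_pdivlMl ?normr_gt0.
Qed.

Lemma l1norm_bd (c : {freeg (G * G)%type / R}) : l1norm (bd c) <= 3 * l1norm c.
Proof.
apply: l1norm_fglift => g; rewrite (le_trans (l1normD _ _))//.
rewrite -scaleN1r (le_trans (lerD (l1normD _ _) (lexx _)))//.
by rewrite l1normZ !l1normU normrN1 mul1r -(natrD R 1 1) -(natrD R 2 1).
Qed.

Lemma mixed_norm0_eq0 c : mixed_norm c = 0 -> c = 0.
Proof.
move=> c0; apply/val_inj/chain_incl_inj; rewrite [RHS]linear0.
apply/l1norm0_eq0/eqP; rewrite eq_le l1norm_ge0 andbT.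
apply/ler_addgt0Pr => e e0; rewrite add0r.
have [u [_ <-]] := mixed_norm_approx c (divr_gt0 e0 (ltr0n R 3)).
rewrite c0 add0r => ue; rewrite (le_trans (l1norm_bd u))//.
by rewrite mulrC -ler_pdivlMr// ltW.
Qed.

HB.instance Definition _ := Lmodule_isNormed.Build R (mixed_chain N R)
  mixed_normD mixed_normZ mixed_norm0_eq0.

End FillingNorm.

Section HomogenizedChains.
Variables (R : realType) (G : groupType) (N : groupClosed G).

Definition h_pred : {pred mixed_chain N R} := fun c =>
  `[< lspan [set y | exists (x : subgrp N) (k : int),
                      y = << zpow x k >> - k%:~R *: << x >>] (val c) >].

Lemma h_pred_submod : GRing.submod_closed h_pred.
Proof.
split=> [|a c d /asboolP hc /asboolP hd]; apply/asboolP.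
  by rewrite linear0; exact: lspan0.
by rewrite linearP; exact: lspan_linear.
Qed.
HB.instance Definition _ :=
  GRing.isSubmodClosed.Build R (mixed_chain N R) h_pred h_pred_submod.

Definition Ch : Type := quot_closure h_pred.
HB.instance Definition _ := NormedModule.on Ch.

Definition Ch_class (c : mixed_chain N R) : Ch := quotpi (closurep h_pred) c.

(* The canonical map from C_Q(G, N) to C^h(G, N), whose image is C^h_Q(G, N). *)
Definition ChQ_class (c : mixed_chain N rat) : Ch :=
  Ch_class (mixed_change ratr c).

End HomogenizedChains.

Section MixedScl.
Variables (R : realType) (G : groupType) (N : groupClosed G).

(* The inverse of a commutator [g, x] is the commutator [g^-1, g x g^-1], so this
   is +oo exactly when y is not in the subgroup [G, N]. *)
Definition cl (y : G) : \bar R :=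
  ereal_inf [set (size s)%:R%:E | s in
    [set s : seq (G * subgrp N) |
       y = (\prod_(p <- s) commL p.1 (subgrp_incl p.2))%g]].

(* The elements of [ab.1] and [ab.2] pair each term of the expression
   [\sum_(x <- xs) x - \sum_(y <- ys) y] with an element of [G] conjugating it. *)
Definition cl_expr (xs ys : seq (subgrp N)) : \bar R :=
  ereal_inf [set cl ((\prod_(p <- ab.1) conjL p.1 (subgrp_incl p.2)) *
                     (\prod_(p <- ab.2) (conjL p.1 (subgrp_incl p.2))^-1))%g
            | ab in [set ab : seq (G * subgrp N) * seq (G * subgrp N) |
                       unzip2 ab.1 = xs /\ unzip2 ab.2 = ys]].

Definition scl_expr (xs ys : seq (subgrp N)) : R :=
  limn (fun k => fine (cl_expr [seq (x ^+ k)%g | x <- xs]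
                               [seq (y ^+ k)%g | y <- ys]) / k%:R).

Definition expresses (z : mixed_chain N int)
    (e : seq (subgrp N) * seq (subgrp N)) :=
  val z = \sum_(x <- e.1) << x >> - \sum_(y <- e.2) << y >>.

(* The values below depend neither on the chosen expression of [z] nor on the
   chosen multiple of [c]. *)
Definition sclZ (z : mixed_chain N int) : R :=
  let e := xget ([::], [::]) (expresses z) in scl_expr e.1 e.2.

Definition scl (c : mixed_chain N rat) : R :=
  let kz := xget (1%N, 0) [set kz : nat * mixed_chain N int |
    (0 < kz.1)%N /\ mixed_change intr kz.2 = kz.1%:R *: c] in
  sclZ kz.2 / kz.1%:R.

End MixedScl.

Section Quasimorphisms.
Variable R : realType.
Implicit Type H : groupType.

Definition edefect H (f : H -> R) : \bar R :=
  ereal_sup [set `|f (h.1 * h.2)%g - f h.1 - f h.2|%:E | h in [set: H * H]].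

Definition defect H (f : H -> R) : R := fine (edefect f).

Definition is_quasimorphism H (f : H -> R) := (edefect f < +oo)%E.

Definition is_hom H (f : H -> R) := forall x y, f (x * y)%g = f x + f y.

Definition is_homogeneous H (f : H -> R) :=
  forall x i j, f (zpow x i * zpow x j)%g = f (zpow x i) + f (zpow x j).

Lemma le_defect H (f : H -> R) x y : is_quasimorphism f ->
  `|f (x * y)%g - f x - f y| <= defect f.
Proof.
move=> qf; have h : (`|f (x * y)%g - f x - f y|%:E <= edefect f)%E.
  by apply: ereal_sup_ubound; exists (x, y).
by rewrite -lee_fin fineK// fin_numElt (lt_le_trans (ltNyr _) h).
Qed.

Lemma defect_ge0 H (f : H -> R) : is_quasimorphism f -> 0 <= defect f.
Proof. by move=> /(le_defect 1%g 1%g); exact: le_trans. Qed.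

Lemma defect_le H (f : H -> R) M :
  (forall x y, `|f (x * y)%g - f x - f y| <= M) ->
  is_quasimorphism f /\ defect f <= M.
Proof.
move=> fM; have h : (edefect f <= M%:E)%E.
  by apply: ge_ereal_sup => _ [[x y] _ <-]; rewrite lee_fin; exact: fM.
have qf : is_quasimorphism f by exact: le_lt_trans h (ltry _).
split=> //; rewrite -lee_fin fineK// fin_numElt; apply/andP; split=> //.
apply: lt_le_trans (ltNyr `|f (1 * 1)%g - f 1%g - f 1%g|) _.
by apply: ereal_sup_ubound; exists (1%g, 1%g).
Qed.

Lemma defectD H (f g : H -> R) : is_quasimorphism f -> is_quasimorphism g ->
  is_quasimorphism (f + g) /\ defect (f + g) <= defect f + defect g.
Proof.
move=> qf qg; apply: defect_le => x y; rewrite !fctE.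
have -> : f (x * y)%g + g (x * y)%g - (f x + g x) - (f y + g y) =
  (f (x * y)%g - f x - f y) + (g (x * y)%g - g x - g y).
  by ring.
by rewrite (le_trans (ler_normD _ _))// lerD// le_defect.
Qed.

Lemma defectZ_le H a (f : H -> R) : is_quasimorphism f ->
  is_quasimorphism (a *: f) /\ defect (a *: f) <= `|a| * defect f.
Proof.
move=> qf; apply: defect_le => x y; rewrite !fctE -!scalerBr normrZ.
by rewrite ler_wpM2l// le_defect.
Qed.

Lemma defectZ H a (f : H -> R) : is_quasimorphism f ->
  defect (a *: f) = `|a| * defect f.
Proof.
move=> qf; have [qaf le1] := defectZ_le a qf.
apply/eqP; rewrite eq_le le1 /=; have [->|a0] := eqVneq a 0.
  by rewrite normr0 mul0r; apply: defect_ge0; exact: (defectZ_le 0 qf).1.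
have [_] := defectZ_le a^-1 qaf; rewrite scalerA mulVf// scale1r normfV.
by rewrite ler_pdivlMl ?normr_gt0.
Qed.

Lemma is_hom_quasimorphism H (f : H -> R) :
  is_hom f -> is_quasimorphism f /\ defect f <= 0.
Proof.
move=> hf; apply: defect_le => x y.
by rewrite hf -addrA -opprD subrr normr0.
Qed.

Lemma defect0_hom H (f : H -> R) : is_quasimorphism f -> defect f = 0 -> is_hom f.
Proof.
move=> qf f0 x y; have := le_defect x y qf.
by rewrite f0 normr_le0 -addrA -opprD subr_eq0 => /eqP.
Qed.

End Quasimorphisms.

Section InvariantQuasimorphisms.
Variables (R : realType) (G : groupType) (N : groupClosed G).

Definition is_invariant (f : subgrp N -> R) :=
  forall (g : G) (x y : subgrp N),
    subgrp_incl y = conjL g (subgrp_incl x) -> f y = f x.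

Definition QG_pred : {pred subgrp N -> R^o} := fun f =>
  `[< [/\ is_quasimorphism f, is_homogeneous f & is_invariant f] >].

Lemma QG_pred_submod : GRing.submod_closed QG_pred.
Proof.
split=> [|a f g /asboolP[qf hf vf] /asboolP[qg hg vg]]; apply/asboolP; split.
- by have [] := @is_hom_quasimorphism R (subgrp N) (fun=> 0) (fun _ _ => esym (addr0 0)).
- by move=> x i j; rewrite -[RHS]/(0 + 0) addr0.
- by [].
- by have [] := defectD (defectZ_le a qf).1 qg.
- by move=> x i j; rewrite !fctE hf hg scalerDr addrACA.
- by move=> u x y xy; rewrite !fctE (vf _ _ _ xy) (vg _ _ _ xy).
Qed.
HB.instance Definition _ :=
  GRing.isSubmodClosed.Build R (subgrp N -> R^o) QG_pred QG_pred_submod.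

Definition QG : Type := {f : subgrp N -> R^o | f \in QG_pred}.
HB.instance Definition _ := [isSub of QG for @sval _ _].
HB.instance Definition _ := [Choice of QG by <:].
HB.instance Definition _ := [SubChoice_isSubLmodule of QG by <:].

Definition QG_fun (f : QG) : subgrp N -> R^o := val f.

(* H^1(N)^G inside Q(N)^G. *)
Definition H1G_pred : {pred QG} := fun f => `[< is_hom (QG_fun f) >].

Lemma H1G_pred_submod : GRing.submod_closed H1G_pred.
Proof.
split=> [|a f g /asboolP hf /asboolP hg]; apply/asboolP => x y.
  by rewrite -[RHS]/(0 + 0) addr0.
have -> : QG_fun (a *: f + g) = a *: QG_fun f + QG_fun g by [].
by rewrite !fctE hf hg scalerDr addrACA.
Qed.
HB.instance Definition _ :=
  GRing.isSubmodClosed.Build R QG H1G_pred H1G_pred_submod.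

Definition QG_mod_H1G : Type := quotmod H1G_pred.
HB.instance Definition _ := GRing.Lmodule.on QG_mod_H1G.

Definition QG_class (f : QG) : QG_mod_H1G := quotpi H1G_pred f.

Lemma QG_quasimorphism (f : QG) : is_quasimorphism (QG_fun f).
Proof. by have /asboolP[] := valP f. Qed.

Definition twice_defect (q : QG_mod_H1G) : R := 2 * defect (QG_fun (quotrep q)).

Lemma twice_defect_class f : twice_defect (QG_class f) = 2 * defect (QG_fun f).
Proof.
congr (2 * _); set g := quotrep _; have /asboolP h := quotrep_pi H1G_pred f.
have [qh h0] := is_hom_quasimorphism h.
have [_ gh] := defectD qh (QG_quasimorphism f).
have [qNh Nh0] := defectZ_le (-1) qh.
have [_ fh] := defectD qNh (QG_quasimorphism g).
apply/eqP; rewrite eq_le; apply/andP; split.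
  have gE : QG_fun g = QG_fun (g - f) + QG_fun f.
    by apply/funext => x; rewrite /QG_fun /= !fctE subrK.
  by rewrite gE (le_trans gh)// gerDr.
have fE : QG_fun f = -1 *: QG_fun (g - f) + QG_fun g.
  by apply/funext => x; rewrite /QG_fun /= !fctE scaleN1r opprB subrK.
rewrite fE (le_trans fh)// gerDr (le_trans Nh0)//.
by rewrite normrN1 mul1r.
Qed.

Lemma twice_defectD p q :
  twice_defect (p + q) <= twice_defect p + twice_defect q.
Proof.
rewrite -[p]quotrepK -[q]quotrepK -linearD.
rewrite -!/(QG_class _) !twice_defect_class -mulrDr ler_pM2l ?ltr0n//.
exact: (defectD (QG_quasimorphism _) (QG_quasimorphism _)).2.
Qed.

Lemma twice_defectZ a q : twice_defect (a *: q) = `|a| * twice_defect q.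
Proof.
rewrite -[q]quotrepK -linearZ -!/(QG_class _) !twice_defect_class mulrCA.
by congr (2 * _); exact: defectZ (QG_quasimorphism _).
Qed.

Lemma twice_defect0_eq0 q : twice_defect q = 0 -> q = 0.
Proof.
move=> /eqP; rewrite mulf_eq0 pnatr_eq0 /= => /eqP q0.
rewrite -[q]quotrepK -(linear0 (quotpi H1G_pred)); apply/quotpi_eqP.
by rewrite subr0; apply/asboolP/defect0_hom => //; exact: QG_quasimorphism.
Qed.

(* The norm 2 D_N on Q(N)^G / H^1(N)^G. *)
Definition twice_defect_norm : norm_on QG_mod_H1G :=
  NormOn twice_defectD twice_defectZ twice_defect0_eq0.

Definition eval_chain (f : QG) (c : mixed_chain N R) : R :=
  fglift (QG_fun f) (val c).

End InvariantQuasimorphisms.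

Section Statements.
Variables (R : realType) (G : groupType) (N : groupClosed G).

Definition is_scl_extension (F : Ch R N -> R) :=
  [/\ forall q, 0 <= F q,
      continuous F
    & forall c : mixed_chain N rat, F (ChQ_class R c) = scl R c].

Definition is_evaluation_pairing (B : QG_mod_H1G R N -> Ch R N -> R) :=
  forall (mu : QG R N) (c : mixed_chain N R),
    B (QG_class mu) (Ch_class c) = eval_chain mu c.

End Statements.

(* Main.v *)
Require Import Defs.
From HB Require Import structures.
From mathcomp Require Import all_boot all_order all_algebra.
From mathcomp Require Import freeg.
From mathcomp Require Import all_classical all_reals all_analysis.
From mathcomp Require Import ring lra zify.
Set Implicit Arguments.
Unset Strict Implicit.
Unset Printing Implicit Defensive.
Import Order.TTheory GRing.Theory Num.Theory.
Import numFieldNormedType.Exports.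
Local Open Scope classical_set_scope.
Local Open Scope ring_scope.

(** For any expression of an integral chain [z], the mixed commutator length of
    its [k]-th powers is [k * |z|_h / 2] up to an error [o(k)]; this contains
    both the existence of the limit defining scl and (1).

    Lower bound: modulo the closure of [h(G, N)] a chain [x - g x g^-1] vanishes,
    because its multiples are represented by [x^n - g x^n g^-1], of norm at most
    2. So a commutator has norm at most 1, a product of [n] commutators has norm
    at most [2 n], and splitting a product into its factors costs a constant.

    Upper bound: a filling [c'] of [z + h] is pushed to [N] by a retraction
    [phi : G -> N] compatible with multiplication by [N] up to conjugation. It
    turns every pair of [c'] into a chain [y' - x y + x] with [y'] conjugate to
    [y]. As [x^k y^k (x y)^-k] is a product of about [k / 2] commutators, each
    such chain contributes at most 1/2. The real coefficients can be replaced by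
    rational ones, since a linear system with integral data that has a real
    solution has rational solutions nearby.

    The same approximation shows that the rational classes are dense, hence (2).
    For the duality, the retraction gives [|mu(c)| <= D(mu) |c|_h], with equality
    approached on the chains [x - x y + y]; conversely a bounded functional on
    [C^h(G, N)], extended linearly from [C_R(G, N)] to all chains on [N] and
    restricted to the basis, is an invariant homogeneous quasimorphism. *)

(** * Integer powers in a group *)

Section IntegerPowers.
Local Open Scope group_scope.
Variable G : groupType.
Implicit Types x y : G.

Lemma zpowN x (k : int) : zpow x (- k) = (zpow x k)^-1.
Proof. by case: k => [[|n]|n] //=; rewrite ?invg1 ?invgK. Qed.

Lemma zpowS x (k : int) : zpow x (1 + k)%R = x * zpow x k.
Proof.
case: k => [n|[|n]]; first by rewrite -PoszD add1n /= expgS.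
  by rewrite NegzE subrr /= mulgV.
have -> : (1 + Negz n.+1 = Negz n)%R by lia.
by rewrite /= [X in _ * X^-1]expgSr invgM mulVKg.
Qed.

Lemma zpowD x (i j : int) : zpow x (i + j)%R = zpow x i * zpow x j.
Proof.
have zpow_nat (n : nat) k : zpow x (n%:Z + k)%R = x ^+ n * zpow x k.
  elim: n => [|n IHn]; first by rewrite add0r mul1g.
  have -> : (n.+1%:Z + k = 1 + (n%:Z + k))%R by lia.
  by rewrite zpowS IHn mulgA -expgS.
case: i => n; first exact: zpow_nat.
apply: (mulgI (x ^+ n.+1)); rewrite -zpow_nat mulVKg; congr zpow.
by rewrite NegzE addNKr.
Qed.

Lemma zpowMn x (k : int) n : zpow x (n%:Z * k)%R = zpow x k ^+ n.
Proof.
elim: n => [|n IHn]; first by rewrite mul0r.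
by rewrite -addn1 addnC PoszD mulrDl mul1r zpowD IHn add1n expgS.
Qed.

Lemma zpowMz x (k j : int) : zpow x (j * k)%R = zpow (zpow x k) j.
Proof.
case: j => n; first exact: zpowMn.
by rewrite NegzE mulNr !zpowN; congr _^-1; exact: zpowMn.
Qed.

Lemma zpow_conj x g k : zpow (conjL g x) k = conjL g (zpow x k).
Proof.
rewrite /conjL.
have natE n : (g * x * g^-1) ^+ n = g * x ^+ n * g^-1.
  elim: n => [|n IHn]; first by rewrite mulg1 mulgV.
  by rewrite !expgS IHn !mulgA mulgVK.
by case: k => n /=; rewrite natE // !invgM invgK mulgA.
Qed.

End IntegerPowers.

(** * Counting mixed commutators *)

Section CommutatorCount.
Variables (G : groupType) (N : groupClosed G) (N_normal : is_normal N).
Local Open Scope group_scope.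
Implicit Types (g : G) (x y z : subgrp N).

Lemma incl_inj : injective (@subgrp_incl G N). Proof. exact: val_inj. Qed.
Lemma inclM x y : subgrp_incl (x * y) = subgrp_incl x * subgrp_incl y.
Proof. by []. Qed.
Lemma incl1 : subgrp_incl (1 : subgrp N) = 1. Proof. by []. Qed.
Lemma inclV x : subgrp_incl x^-1 = (subgrp_incl x)^-1.
Proof. exact: (gmulfV (val : subgrp N -> G)). Qed.
Lemma inclX x n : subgrp_incl (x ^+ n) = subgrp_incl x ^+ n.
Proof. exact: (gmulfXn (val : subgrp N -> G)). Qed.
Lemma incl_zpow x k : subgrp_incl (zpow x k) = zpow (subgrp_incl x) k.
Proof. by case: k => n /=; rewrite ?inclV inclX. Qed.
Lemma incl_prod I (s : seq I) (F : I -> subgrp N) :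
  subgrp_incl (\prod_(i <- s) F i) = \prod_(i <- s) subgrp_incl (F i).
Proof. exact: (big_morph _ inclM incl1). Qed.

Definition conjN g x : subgrp N :=
  Sub (conjL g (subgrp_incl x)) (N_normal g (valP x)).

Lemma incl_conjN g x : subgrp_incl (conjN g x) = conjL g (subgrp_incl x).
Proof. exact: SubK. Qed.

(** An upper bound in [nat] in place of the infimum [cl], whose values are extended reals. *)
Definition ncomm (n : nat) y := exists2 s : seq (G * subgrp N),
  (size s <= n)%N & subgrp_incl y = \prod_(p <- s) commL p.1 (subgrp_incl p.2).

Lemma ncomm_leq m n y : (m <= n)%N -> ncomm m y -> ncomm n y.
Proof. by move=> mn [s sm ys]; exists s => //; exact: leq_trans mn. Qed.

Lemma ncomm1 : ncomm 0 1. Proof. by exists [::]; rewrite ?big_nil. Qed.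

Lemma ncomm_comm g x : ncomm 1 (conjN g x * x^-1).
Proof.
by exists [:: (g, x)] => //; rewrite big_seq1 inclM incl_conjN inclV.
Qed.

Lemma ncommM m n y z : ncomm m y -> ncomm n z -> ncomm (m + n) (y * z).
Proof.
move=> [s sm ys] [t tn zt]; exists (s ++ t); first by rewrite size_cat leq_add.
by rewrite inclM ys zt big_cat.
Qed.

Lemma conjL_prod g I (s : seq I) (F : I -> G) :
  conjL g (\prod_(i <- s) F i) = \prod_(i <- s) conjL g (F i).
Proof.
apply: (big_morph (conjL g)) => [a b|]; rewrite /conjL ?mulg1 ?mulgV //.
by rewrite !mulgA mulgVK.
Qed.

Lemma ncommJ g n y : ncomm n y -> ncomm n (conjN g y).
Proof.
move=> [s sn ys]; exists [seq (conjL g p.1, conjN g p.2) | p <- s].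
  by rewrite size_map.
rewrite incl_conjN ys conjL_prod big_map; apply: eq_bigr => p _.
by rewrite /= incl_conjN /conjL /commL !invgM !invgK !mulgA !mulgVK.
Qed.

Lemma ncommV n y : ncomm n y -> ncomm n y^-1.
Proof.
move=> [s sn ys]; exists (rev [seq (p.1^-1, conjN p.1 p.2) | p <- s]).
  by rewrite size_rev size_map.
rewrite inclV ys {sn ys}; elim: s => [|p s IHs]; first by rewrite !big_nil invg1.
rewrite big_cons /= rev_cons -cats1 big_cat big_seq1 -IHs invgM /=; congr (_ * _).
by rewrite incl_conjN /conjL /commL !invgM !invgK !mulgA !mulVg mul1g mulgVK.
Qed.

(** A quantitative equality modulo [[G, N]]: [n] bounds the commutators spent. *)
Definition cnear n x y := ncomm n (x * y^-1).

Lemma cnear_refl x n : cnear n x x.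
Proof. by rewrite /cnear mulgV; apply: (ncomm_leq (leq0n n)); exact: ncomm1. Qed.

Lemma cnear_leq m n x y : (m <= n)%N -> cnear m x y -> cnear n x y.
Proof. exact: ncomm_leq. Qed.

Lemma cnear_sym n x y : cnear n x y -> cnear n y x.
Proof. by move=> /ncommV; rewrite invgM invgK. Qed.

Lemma cnear_trans y m n x z : cnear m x y -> cnear n y z -> cnear (m + n) x z.
Proof. by move=> xy yz; have := ncommM xy yz; rewrite mulgA mulgVK. Qed.

Lemma ncomm_cnear m n x y : cnear m x y -> ncomm n y -> ncomm (m + n) x.
Proof. by move=> xy ny; have := ncommM xy ny; rewrite mulgVK. Qed.

Lemma cnearMr n x y z : cnear n x y -> cnear n (x * z) (y * z).
Proof. by rewrite /cnear invgM mulgA mulgK. Qed.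

Lemma cnearMl n x y z : cnear n x y -> cnear n (z * x) (z * y).
Proof.
move=> /(ncommJ (subgrp_incl z)); rewrite /cnear; congr ncomm; apply: incl_inj.
by rewrite incl_conjN /conjL !inclM !inclV inclM invgM !mulgA.
Qed.

Lemma cnearM m n x x' y y' :
  cnear m x x' -> cnear n y y' -> cnear (m + n) (x * y) (x' * y').
Proof.
by move=> /(cnearMr y) h /(cnearMl x') h'; exact: cnear_trans h h'.
Qed.

Lemma cnear_conj g x : cnear 1 (conjN g x) x. Proof. exact: ncomm_comm. Qed.

Lemma cnearC x y : cnear 1 (x * y) (y * x).
Proof.
have := cnearMr x (cnear_conj (subgrp_incl x) y).
congr cnear; apply: incl_inj.
by rewrite !inclM incl_conjN /conjL mulgVK.
Qed.

(** The head of [s] is brought to the front of [t] by a rotation, which exchanges two blocks and so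
    costs one commutator. *)
Lemma cnear_perm (I : eqType) (s t : seq I) (f : I -> subgrp N) : perm_eq s t ->
  cnear (size s) (\prod_(i <- s) f i) (\prod_(i <- t) f i).
Proof.
elim: s t => [|i s IHs] t st.
  have /perm_nilP -> : perm_eq t [::] by rewrite perm_sym.
  by rewrite !big_nil; exact: cnear_refl.
have /rot_to[k t' tE] : i \in t by rewrite -(perm_mem st) mem_head.
have st' : perm_eq s t' by rewrite -(perm_cons i) -tE perm_sym perm_rot perm_sym.
rewrite big_cons /= -addn1.
apply: (@cnear_trans (\prod_(j <- rot k t) f j)).
  by rewrite tE big_cons; exact/cnearMl/IHs.
by rewrite /rot big_cat /= -{3}(cat_take_drop k t) big_cat; exact: cnearC.
Qed.

Lemma cnear_prodM (I : Type) (s : seq I) (f g : I -> subgrp N) :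
  cnear (size s) (\prod_(i <- s) (f i * g i))
    (\prod_(i <- s) f i * \prod_(i <- s) g i).
Proof.
elim: s => [|i s IHs]; first by rewrite !big_nil mul1g; exact: cnear_refl.
rewrite !big_cons /= -addn1 -!mulgA; apply: cnearMl.
apply: (cnear_trans (cnearMl (g i) IHs)).
by rewrite !mulgA; apply: cnearMr; exact: cnearC.
Qed.

Lemma cnear_prodV (I : Type) (s : seq I) (f : I -> subgrp N) :
  cnear (size s) (\prod_(i <- s) (f i)^-1) (\prod_(i <- s) f i)^-1.
Proof.
elim: s => [|i s IHs]; first by rewrite !big_nil invg1; exact: cnear_refl.
rewrite !big_cons /= -addn1 invgM; apply: (cnear_trans (cnearMl _ IHs)).
exact: cnearC.
Qed.

End CommutatorCount.

(** * Powers of integral chains and bounds on their growth *)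

Section ChainPowers.
Variables (R : realType) (G : groupType) (N : groupClosed G).
Variable N_normal : is_normal N.
Local Notation Nt := (subgrp N).
Local Notation chain := {freeg Nt / int}.
Local Notation conjN := (conjN N_normal).
Implicit Types (c d : chain) (k n C : nat) (x y : Nt).

(** A representative of the [k]-th power of the chain [c], with factors in the arbitrary order of
    [dom c]; up to a number of commutators independent of [k] it is additive in [c]. *)
Definition cprod k c : Nt := (\prod_(x <- dom c) zpow x (k%:Z * coeff x c)%R)%g.

Lemma cprod_sub (s : seq Nt) c k : uniq s -> {subset dom c <= s} ->
  cnear (size s) (\prod_(x <- s) zpow x (k%:Z * coeff x c)%R)%g (cprod k c).
Proof.
move=> us cs; have -> : (\prod_(x <- s) zpow x (k%:Z * coeff x c)%R =
    \prod_(x <- [seq x <- s | x \in dom c]) zpow x (k%:Z * coeff x c)%R)%g.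
  rewrite big_filter [RHS]big_mkcond; apply: eq_bigr => x _.
  by case: ifPn => // /coeff_outdom ->; rewrite mulr0.
apply: (cnear_leq _ (cnear_perm N_normal _ _)).
  by rewrite size_filter count_size.
apply: uniq_perm; [exact: filter_uniq|exact: uniq_dom|].
by move=> x; rewrite mem_filter; case: (boolP (x \in dom c)) => [/cs ->|].
Qed.

Lemma cprodU m x k : cprod k << m *g x >> = zpow x (k%:Z * m)%R.
Proof.
rewrite /cprod; have [->|m0] := eqVneq m 0.
  by rewrite freegU0 dom0 big_nil mulr0.
by rewrite domU// big_seq1 coeffU eqxx mulr1.
Qed.

(** On the common support [s] both sides consist of the same powers and only a rearrangement is
    left. Its cost depends on the supports and not on [k], so it disappears after division by
    [k]. *)
Lemma cprodD c d :
  exists C, forall k, cnear C (cprod k (c + d)) (cprod k c * cprod k d)%g.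
Proof.
pose s := undup (dom c ++ dom d).
have us : uniq s by exact: undup_uniq.
have cs : {subset dom c <= s} by move=> x xc; rewrite mem_undup mem_cat xc.
have ds : {subset dom d <= s} by move=> x xd; rewrite mem_undup mem_cat xd orbT.
have cds : {subset dom (c + d) <= s}.
  by move=> x /domD_subset; rewrite mem_undup.
exists (size s + (size s + (size s + size s)))%N => k.
apply: (cnear_trans (cnear_sym N_normal (cprod_sub k us cds))).
under eq_bigr do rewrite coeffD mulrDr zpowD.
apply: (cnear_trans (cnear_prodM N_normal _ _ _)).
exact: (cnearM N_normal (cprod_sub k us cs) (cprod_sub k us ds)).
Qed.

Lemma cprod0 k : cprod k 0 = 1%g. Proof. by rewrite /cprod dom0 big_nil. Qed.

Lemma cprodN c : exists C, forall k, cnear C (cprod k (- c)) (cprod k c)^-1%g.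
Proof.
have [C hC] := cprodD (- c) c; exists C => k; have := hC k.
rewrite addNr cprod0 => /(cnear_sym N_normal); rewrite /cnear invg1 mulg1.
by rewrite invgK.
Qed.

(** The two products differ at most in the order of their factors and, for [m = 0], by trivial
    factors. *)
Lemma cprodM c (m : nat) :
  exists C, forall k, cnear C (cprod k (m%:Z *: c)) (cprod (m * k) c).
Proof.
exists (size (dom c)) => k.
have := cprod_sub k (uniq_dom c) (@domZ_subset _ _ m%:Z c).
move=> /(cnear_sym N_normal); congr cnear; rewrite /cprod.
by apply: eq_bigr => x _; rewrite coeffZ mulrA -PoszM mulnC.
Qed.

Lemma cprod_addn c m n :
  cnear (size (dom c)) (cprod (m + n) c) (cprod m c * cprod n c)%g.
Proof.
rewrite /cprod; under eq_bigr do rewrite PoszD mulrDl zpowD.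
exact: cnear_prodM.
Qed.

(* Amounts to [scl c <= r], without any limit. *)
Definition scl_le (r : R) c := exists C, forall k,
  exists2 n, n%:R <= r * k%:R + C%:R & ncomm n (cprod k c).

Lemma scl_leD r r' c d : scl_le r c -> scl_le r' d -> scl_le (r + r') (c + d).
Proof.
move=> [C hC] [D hD]; have [E hE] := cprodD c d; exists (E + (C + D))%N => k.
have [n nC cn] := hC k; have [m mD dm] := hD k.
exists (E + (n + m))%N; last exact: (ncomm_cnear (hE k) (ncommM cn dm)).
by rewrite mulrDl !natrD; lra.
Qed.

Lemma scl_leN r c : scl_le r c -> scl_le r (- c).
Proof.
move=> [D hD]; have [C hC] := cprodN c; exists (C + D)%N => k.
have [n nD dn] := hD k.
exists (C + n)%N; last exact: ncomm_cnear (hC k) (ncommV N_normal dn).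
by rewrite !natrD; lra.
Qed.

Lemma scl_le0 : scl_le 0 0.
Proof.
exists 0%N => k; exists 0%N; rewrite ?cprod0; last exact: ncomm1.
by rewrite mul0r addr0.
Qed.

Lemma scl_leZ r c (m : int) : scl_le r c -> scl_le (`|m|%:~R * r) (m *: c).
Proof.
move=> rc; have hn (n : nat) : scl_le (n%:R * r) (n%:Z *: c).
  elim: n => [|n IHn]; first by rewrite mul0r scale0r; exact: scl_le0.
  by rewrite -addn1 natrD PoszD mulrDl mul1r scalerDl scale1r; exact: scl_leD.
case: m => n; first exact: hn.
by rewrite NegzE normrN scaleNr; exact/scl_leN/hn.
Qed.

Lemma scl_le_sum (I : eqType) (s : seq I) (F : I -> chain) (r : I -> R) :
  {in s, forall i, scl_le (r i) (F i)} ->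
  scl_le (\sum_(i <- s) r i) (\sum_(i <- s) F i).
Proof.
elim: s => [|i s IHs] rF; first by rewrite !big_nil; exact: scl_le0.
rewrite !big_cons; apply: scl_leD; first exact/rF/mem_head.
by apply: IHs => j js; apply: rF; rewrite inE js orbT.
Qed.

(** Write [k = M q + t] with [t < M]: the bound on [M c] covers the first part, and the rest is one
    of finitely many powers. The crude bound [r'] ensures that these are products of commutators at
    all. *)
Lemma scl_le_div r r' c (M : nat) : (0 < M)%N ->
  scl_le r' c -> scl_le (M%:R * r) (M%:Z *: c) -> scl_le r c.
Proof.
move=> M0 [C' hC'] [C hC]; have [D hD] := cprodM c M.
set E := size (dom c).
have [B hB] : exists B : nat, forall t, (t < M)%N ->
    exists2 n, (n <= B)%N & ncomm n (cprod t c).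
  exists (Num.truncn (`|r'| * M%:R + C'%:R)) => t tM.
  have [n nC' cn] := hC' t; exists n => //.
  rewrite truncn_ge_nat ?addr_ge0 ?mulr_ge0//; apply: (le_trans nC').
  rewrite lerD2r (le_trans (ler_norm _))// normrM ler_wpM2l//.
  by rewrite normr_nat ler_nat ltnW.
(* The last summand absorbs [- r * (k %% M)], which can be positive because the sign of [r] is not
   fixed. *)
exists (E + (D + C + B) + (Num.truncn (`|r| * M%:R)%R).+1)%N => k.
have [n nC cn] := hC (k %/ M)%N.
have tM : (k %% M < M)%N by rewrite ltn_mod.
have [m mB cm] := hB _ tM.
exists (E + (D + n + m))%N; last first.
  apply: (ncomm_cnear (y := (cprod (M * (k %/ M)) c * cprod (k %% M) c)%g)).
    by have := cprod_addn c (M * (k %/ M)) (k %% M); rewrite mulnC -divn_eq.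
  exact: ncommM (ncomm_cnear (cnear_sym N_normal (hD _)) cn) cm.
have mB' : m%:R <= B%:R :> R by rewrite ler_nat.
have kE : k%:R = (k %/ M)%:R * M%:R + (k %% M)%:R :> R.
  by rewrite -natrM -natrD -divn_eq.
have rt : - (r * (k %% M)%:R) <= `|r| * M%:R :> R.
  rewrite (le_trans (ler_norm _))// normrN normrM ler_wpM2l//.
  by rewrite normr_nat ler_nat ltnW.
have : `|r| * M%:R < (Num.truncn (`|r| * M%:R)).+1%:R :> R by exact: truncnS_gt.
move: nC; rewrite kE !natrD -[_.+1%:R]natr1; nra.
Qed.

End ChainPowers.

(** * The cost of triangles, power relations and expressions *)

Section SclOfRelations.
Variables (R : realType) (G : groupType) (N : groupClosed G).
Variable N_normal : is_normal N.
Local Notation Nt := (subgrp N).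
Local Notation chain := {freeg Nt / int}.
Implicit Types (c d : chain) (k n C : nat) (x y : Nt).

Lemma ncomm_step x y k n :
  (ncomm n ((x^-1 * y^-1) ^+ k * x ^+ k * y ^+ k) ->
   ncomm n.+1 ((x^-1 * y^-1) ^+ k.+2 * x ^+ k.+2 * y ^+ k.+2))%g.
Proof.
(* After cyclic rotation the word is A B C a Z b c W with a, b, c inverse to
   A, B, C and A = y, B = x^-1, C = y^-1 x^-1; exchanging the blocks B C and
   a Z b turns it into Z W. *)
set Z := ((x^-1 * y^-1) ^+ k * x ^+ k)%g; set W := (y ^+ k)%g => ZW.
have h : ncomm n.+1 (y * (x^-1 * (y^-1 * x^-1)) * (y^-1 * Z * x) * (x * y * W))%g.
  apply: (ncomm_cnear (m := 1) _ ZW).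
  apply: (cnear_trans (m := 1) (n := 0) (y :=
    (y * (y^-1 * Z * x) * (x^-1 * (y^-1 * x^-1)) * (x * y * W))%g)).
    apply: cnearMr; rewrite -!(mulgA y); apply: (cnearMl N_normal); exact: cnearC.
  by rewrite !mulgA mulgV mul1g mulgK !mulgVK; exact: cnear_refl.
have := ncommJ N_normal (subgrp_incl y^-1)%g h; congr ncomm; apply: incl_inj.
rewrite incl_conjN /conjL -!inclV -!inclM; congr subgrp_incl; rewrite /Z /W invgK.
rewrite [(y ^+ k.+2)%g]expgSr [(y ^+ k.+1)%g]expgS.
rewrite [(x ^+ k.+2)%g]expgSr [(x ^+ k.+1)%g]expgSr.
rewrite [((_ * _) ^+ k.+2)%g]expgS [((_ * _) ^+ k.+1)%g]expgS.
by rewrite !mulgA mulVg mul1g.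
Qed.

(** By [ncomm_step] one commutator pays for two further powers. This ratio is the source of the
    factor 1/2 in the formula for scl. *)
Lemma ncomm_product_power x y k :
  ncomm k./2.+1 ((x * y)^-1 ^+ k * y ^+ k * x ^+ k)%g.
Proof.
rewrite invgM -{2 3 4}(odd_double_half k).
elim: (k./2) (odd k) => [|j IHj] b.
  rewrite double0 addn0; case: b; last first.
    by apply: (ncomm_leq (m := 0)) => //; rewrite !expg0 !mulg1; exact: ncomm1.
  have := ncomm_comm N_normal (subgrp_incl y^-1)%g (x^-1)%g.
  congr ncomm; apply: incl_inj.
  by rewrite !inclM !inclV incl_conjN /conjL !inclV !invgK.
rewrite doubleS !addnS; apply: ncomm_step; exact: IHj.
Qed.

Lemma freegUZ (K : nzRingType) (T : choiceType) (a b : K) (x : T) :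
  a *: << b *g x >> = << a * b *g x >>.
Proof. by apply/eqP/freeg_eqP => y; rewrite coeffZ !coeffU mulrA. Qed.

(** Replacing the power of the conjugate by [y ^+ k] and moving the power of [(x * y)^-1] to the
    front cost a bounded number of commutators; [ncomm_product_power] then leaves about [k / 2]. *)
Lemma scl_le_triangle g x y :
  scl_le (2^-1 : R) (<< conjN N_normal g y >> - << (x * y)%g >> + << x >> : chain).
Proof.
set y' := conjN _ _ _.
have [C hC] := cprodD N_normal (<< y' >> - << (x * y)%g >>) << x >>.
have [D hD] := cprodD N_normal << y' >> (- << (x * y)%g >>).
have [E hE] := cprodN N_normal << (x * y)%g >>.
exists (C + D + E + 4)%N => k.
exists (C + (D + (1 + E + (1 + k./2.+1))))%N; last first.
  apply: (ncomm_cnear (hC k)).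
  apply: (ncomm_cnear (cnearMr _ (hD k))).
  have yk : cnear 1 (cprod k << y' >>) (y ^+ k)%g.
    rewrite cprodU mulr1 /=.
    have -> : (y' ^+ k)%g = conjN N_normal g (y ^+ k)%g.
      apply: incl_inj; rewrite inclX !incl_conjN inclX.
      exact: (zpow_conj _ _ k%:Z).
    exact: cnear_conj.
  apply: (ncomm_cnear (cnearMr _ (cnearM N_normal yk (hE k)))).
  rewrite !cprodU !mulr1 /= -!expVgn.
  apply: (ncomm_cnear (cnearMr _ (cnearC N_normal _ _))).
  exact: ncomm_product_power.
rewrite !natrD -natr1.
have -> : k%:R = (k./2)%:R * 2 + (odd k)%:R :> R.
  by rewrite -natrM -natrD muln2 addnC odd_double_half.
by have : 0 <= (odd k)%:R :> R by []; lra.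
Qed.

Lemma scl_le_power x (j : int) :
  scl_le (0 : R) (<< zpow x j >> - j *: << x >> : chain).
Proof.
have [C hC] := cprodD N_normal << zpow x j >> (- (j *: << x >>)).
have [D hD] := cprodN N_normal (j *: << x >>).
exists (C + D)%N => k; exists (C + (D + 0))%N; last first.
  apply: (ncomm_cnear (hC k)).
  apply: (ncomm_cnear (cnearMl N_normal _ (hD k))).
  rewrite freegUZ !cprodU !mulr1 zpowMz mulgV; exact: ncomm1.
by rewrite mul0r add0r addn0.
Qed.

(** The product defining [cl_expr] with all conjugators trivial. *)
Definition expr_prod (xs ys : seq Nt) : Nt :=
  ((\prod_(x <- xs) x) * (\prod_(y <- ys) y^-1))%g.

Lemma cprod_sum (s : seq Nt) : exists C, forall k,
  cnear C (\prod_(x <- s) (x ^+ k))%g (cprod k (\sum_(x <- s) << x >>)).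
Proof.
elim: s => [|x s [C hC]].
  by exists 0%N => k; rewrite !big_nil cprod0; exact: cnear_refl.
have [D hD] := cprodD N_normal << x >> (\sum_(x <- s) << x >>).
exists (C + D)%N => k; rewrite !big_cons.
apply: (cnear_trans (cnearMl N_normal _ (hC k))).
by have := cnear_sym N_normal (hD k); rewrite cprodU mulr1.
Qed.

(** Cancelling and collecting equal terms costs a number of commutators independent of [k], so the
    growth in [k] depends only on the chain and not on its expression. *)
Lemma cprod_expr (xs ys : seq Nt) : exists C, forall k,
  cnear C (expr_prod [seq (x ^+ k)%g | x <- xs] [seq (y ^+ k)%g | y <- ys])
    (cprod k (\sum_(x <- xs) << x >> - \sum_(y <- ys) << y >>)).
Proof.
have [A hA] := cprod_sum xs; have [B hB] := cprod_sum ys.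
set c := \sum_(x <- xs) _; set d := \sum_(y <- ys) _.
have [D hD] := cprodD N_normal c (- d); have [E hE] := cprodN N_normal d.
exists (A + (size ys + (B + (E + D))))%N => k.
rewrite /expr_prod !big_map.
apply: (cnear_trans (cnearMr _ (hA k))).
apply: (cnear_trans (cnearMl N_normal _ (cnear_prodV N_normal _ _))).
apply: (cnear_trans (y := (cprod k c * (cprod k d)^-1)%g)).
  apply: cnearMl => //; rewrite /cnear invgK.
  have := ncommV N_normal (hB k); rewrite invgM invgK => h.
  have := ncommJ N_normal (subgrp_incl (cprod k d)^-1)%g h.
  congr ncomm; apply: incl_inj.
  by rewrite incl_conjN /conjL -!inclV -!inclM !invgK mulgA mulVg mul1g.
apply: (cnear_trans (cnearMl N_normal _ (cnear_sym N_normal (hE k)))).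
exact: cnear_sym (hD k).
Qed.

End SclOfRelations.

(** * Rational approximation of real linear relations *)

Section RationalApproximation.
Variables (R : realType).

(** The kernel over [R] is spanned by the rational rows of [kermx A]; rounding the coefficients [d]
    of [u] in these rows does not leave it. *)
Lemma kermx_rat_approx (m n : nat) (A : 'M[rat]_(m, n)) (u : 'rV[R]_m) (e : R) :
  0 < e -> u *m map_mx ratr A = 0 ->
  exists2 v : 'rV[rat]_m, v *m A = 0 & forall i, `|ratr (v 0 i) - u 0 i| <= e.
Proof.
move=> e0 /sub_kermxP; rewrite -map_kermx => /submxP[d ->].
(* [S] exceeds every absolute column sum of [K], so an error [e / S] in [d] becomes at most [e] in
   [u]; the summand 1 makes it positive. *)
set K := kermx A; pose S : R := \sum_i \sum_j `|ratr (K j i)| + 1.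
have S0 : 0 < S by rewrite ltr_wpDl// !sumr_ge0// => i _; exact: sumr_ge0.
have d0 : 0 < e / S by rewrite divr_gt0.
have /choice[f hf] : forall j, exists q : rat, `|ratr q - d 0 j| <= e / S.
  move=> j; have : d 0 j < d 0 j + e / S by rewrite ltrDl.
  move=> /rat_in_itvoo[q]; rewrite in_itv /= => /andP[q1 q2].
  exists q; rewrite ger0_norm; first by rewrite lerBlDl ltW.
  by rewrite subr_ge0 ltW.
exists ((\row_j f j) *m K); first by rewrite -mulmxA mulmx_ker mulmx0.
move=> i; rewrite !mxE rmorph_sum -sumrB /=.
apply: (le_trans (ler_norm_sum _ _ _)).
apply: (@le_trans _ _ (\sum_j e / S * `|ratr (K j i)|)).
  apply: ler_sum => j _; rewrite !mxE rmorphM -mulrBl normrM.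
  by apply: ler_wpM2r => //; exact: hf.
rewrite -mulr_sumr mulrAC ler_pdivrMr// ler_wpM2l ?(ltW e0)//.
rewrite /S [X in _ <= X + 1](bigD1 i)//= -addrA lerDl addr_ge0// sumr_ge0// => l _.
exact: sumr_ge0.
Qed.

Lemma common_denominator (I : finType) (q : I -> rat) :
  exists2 M : nat, (0 < M)%N & forall i, exists a : int, a%:~R = M%:R * q i.
Proof.
exists (\prod_i `|denq (q i)|)%N.
  by rewrite prodn_gt0// => i; rewrite absz_gt0 denq_neq0.
move=> i; exists (numq (q i) * (\prod_(j | j != i) `|denq (q j)|)%N%:Z).
rewrite [X in _ = X%:R * _](bigD1 i)//= natrM intrM numqE.
set P := (\prod_(j | _) _)%N.
have -> : `|denq (q i)|%N%:R = (denq (q i))%:~R :> rat.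
  by rewrite natr_absz gtr0_norm ?denq_gt0.
by rewrite -pmulrn; ring.
Qed.

(** The relation is read on the finite union [s] of the supports. Solvability over [R] yields a
    rational solution [D]; the real one differs from it by a kernel element, which
    [kermx_rat_approx] approximates, and [M] clears the denominators. *)
Lemma int_relation_approx (T : choiceType) (I : finType)
    (w : I -> {freeg T / int}) (b : {freeg T / int}) (a : I -> R) (e : R) :
  0 < e -> \sum_i a i *: fgchange intr (w i) = fgchange intr b ->
  exists M (A : I -> int), [/\ (0 < M)%N, M%:Z *: b = \sum_i A i *: w i &
    forall i, `|(A i)%:~R - M%:R * a i| <= M%:R * e].
Proof.
move=> e0 ab; pose s := undup (dom b ++ flatten [seq dom (w i) | i <- enum I]).
have wP (c : {freeg T / int}) : {subset dom c <= s} ->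
    forall t, t \notin s -> coeff t c = 0.
  by move=> cs t ts; apply: coeff_outdom; apply: contra ts; exact: cs.
have ws i : {subset dom (w i) <= s}.
  move=> t tw; rewrite mem_undup mem_cat; apply/orP; right.
  by apply/flatten_mapP; exists i; rewrite ?mem_enum.
have bs : {subset dom b <= s} by move=> t tb; rewrite mem_undup mem_cat tb.
pose W : 'M[rat]_(#|I|, size s) :=
  \matrix_(i, j) (coeff (tnth (in_tuple s) j) (w (enum_val i)))%:~R.
pose B : 'rV[rat]_(size s) := \row_j (coeff (tnth (in_tuple s) j) b)%:~R.
pose u : 'rV[R]_#|I| := \row_i a (enum_val i).
have uW : u *m map_mx ratr W = map_mx ratr B.
  apply/rowP => j; rewrite !mxE ratr_int; set t := tnth _ _.
  have := congr1 (coeff t) ab; rewrite coeff_fgchange => <-.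
  rewrite raddf_sum [RHS](reindex _ (onW_bij _ (enum_val_bij I))) /=.
  by apply: eq_bigr => i _; rewrite !mxE coeffZ coeff_fgchange ratr_int.
have BW : (B <= W)%MS.
  by rewrite -(map_submx (ratr : {rmorphism rat -> R})) -uW submxMl.
have [D DB] := submxP BW.
have uD0 : (u - map_mx ratr D) *m map_mx ratr W = 0.
  by rewrite mulmxBl uW DB map_mxM subrr.
have [v vW vu] := kermx_rat_approx e0 uD0.
have DvW : (D + v) *m W = B by rewrite mulmxDl vW addr0 DB.
have [M M0 /choice[A hA]] := common_denominator (fun i => (D + v) 0 (enum_rank i)).
exists M, A; split=> //.
  apply/eqP/freeg_eqP => t; rewrite coeffZ raddf_sum /=.
  have [/(nthP t)[j js jt]|ts] := boolP (t \in s); last first.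
    rewrite (wP b bs)// mulr0 big1// => i _.
    by rewrite coeffZ (wP _ (ws i))// mulr0.
  pose j' := Ordinal js; apply: (intr_inj (R := rat)).
  have := congr1 (fun X : 'rV_(size s) => M%:R * X 0 j') DvW; rewrite !mxE.
  have -> : tnth (in_tuple s) j' = t by rewrite (tnth_nth t).
  rewrite intrM => <-; rewrite mulr_sumr rmorph_sum /=.
  rewrite [RHS](reindex _ (onW_bij _ (enum_val_bij I))) /=.
  apply: eq_bigr => i _; rewrite coeffZ intrM hA enum_valK !mxE.
  by rewrite (tnth_nth t) /= jt mulrA.
move=> i; have := vu (enum_rank i); rewrite !mxE enum_rankK => h.
have -> : (A i)%:~R = M%:R * ratr (D 0 (enum_rank i) + v 0 (enum_rank i)) :> R.
  have := congr1 (@ratr R) (hA i); by rewrite ratr_int rmorphM rmorph_nat !mxE.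
rewrite rmorphD -mulrBr normrM normr_nat ler_wpM2l// (le_trans _ h)//.
suff -> : ratr (D 0 (enum_rank i)) + ratr (v 0 (enum_rank i)) - a i =
  ratr (v 0 (enum_rank i)) - (a i - ratr (D 0 (enum_rank i))) :> R by [].
by ring.
Qed.

End RationalApproximation.

(** * A retraction of the group onto the normal subgroup *)

Section Retraction.
Variables (G : groupType) (N : groupClosed G) (N_normal : is_normal N).
Local Notation Nt := (subgrp N).
Local Notation conjN := (conjN N_normal).

(* With [s] choosing a representative of each coset [N g], the map sends [g] to
   [g (s g)^-1 (s 1)]. *)
Lemma normal_retraction : exists phi : G -> Nt,
  [/\ forall x, phi (subgrp_incl x) = x,
      forall x g, phi (subgrp_incl x * g)%g = (x * phi g)%g
    & forall g x, exists h, phi (g * subgrp_incl x)%g = (phi g * conjN h x)%g].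
Proof.
pose s (g : G) : G := xget 1%g [set h | (h / g)%g \in N].
have sN g : (s g / g)%g \in N.
  rewrite /s; case: xgetP => [h -> //|/(_ g)]; rewrite /= mulgV.
  by move=> /negP; rewrite gpred1.
have sM (x : Nt) g : s (subgrp_incl x * g)%g = s g.
  rewrite /s; congr xget; apply/funext => h /=; rewrite invgM mulgA.
  by rewrite gpredFr //; exact: (valP x).
have phiN g : (g * (s g)^-1 * s 1)%g \in N.
  rewrite (gpredMr (S := N)); first by rewrite gpredFC.
  by have := sN 1%g; rewrite divg1.
pose phi g : Nt := Sub (g * (s g)^-1 * s 1)%g (phiN g).
have phiE g : subgrp_incl (phi g) = (g * (s g)^-1 * s 1)%g by exact: SubK.
have phiM x g : phi (subgrp_incl x * g)%g = (x * phi g)%g.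
  by apply: incl_inj; rewrite inclM !phiE sM !mulgA.
exists phi; split=> // [x|g x].
  rewrite -[subgrp_incl x]mulg1 phiM -[RHS]mulg1; congr (_ * _)%g.
  by apply: incl_inj; rewrite phiE mul1g mulVg.
exists ((s 1)^-1 * s g)%g; apply: incl_inj; rewrite inclM incl_conjN !phiE.
have -> : s (g * subgrp_incl x)%g = s g.
  by rewrite -(sM (conjN g x) g) incl_conjN /conjL mulgVK.
by rewrite /conjL !invgM !invgK !mulgA !mulgK mulgVK.
Qed.

End Retraction.

(** * Fillings pushed to the normal subgroup *)

Section Triangles.
Variables (G : groupType) (N : groupClosed G) (N_normal : is_normal N).
Variable K : nzRingType.
Local Notation Nt := (subgrp N).
Local Notation conjN := (conjN N_normal).
Variable phi : G -> Nt.
Hypothesis phi_incl : forall x, phi (subgrp_incl x) = x.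
Hypothesis phiMl : forall x g, phi (subgrp_incl x * g)%g = (x * phi g)%g.
Hypothesis phiMr : forall g x, exists h,
  phi (g * subgrp_incl x)%g = (phi g * conjN h x)%g.

(** The boundary of the pair [p], pushed from [G] to [N] by [phi]. *)
Definition triangle (p : G * G) : {freeg Nt / K} :=
  << phi p.2 >> - << phi (p.1 * p.2)%g >> + << phi p.1 >>.

(** If [p.1] lies in [N], then [phiMl] applies and the conjugator is trivial; if [p.2] does, [y] is
    its conjugate from [phiMr] and the first term conjugates it back. *)
Lemma triangle_conj p : p.1 \in N \/ p.2 \in N -> exists g x y,
  triangle p = << conjN g y >> - << (x * y)%g >> + << x >>.
Proof.
rewrite /triangle; case: p => g g' /= [] gN.
  have -> : g = subgrp_incl (Sub g gN : Nt) by rewrite [RHS]SubK.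
  set x : Nt := Sub g gN; exists 1%g, x, (phi g'); rewrite phiMl phi_incl.
  suff -> : conjN 1%g (phi g') = phi g' by [].
  by apply: incl_inj; rewrite incl_conjN /conjL mul1g invg1 mulg1.
have -> : g' = subgrp_incl (Sub g' gN : Nt) by rewrite [RHS]SubK.
set x : Nt := Sub g' gN; have [h ->] := phiMr g x.
exists h^-1%g, (phi g), (conjN h x); rewrite phi_incl.
suff -> : conjN h^-1 (conjN h x) = x by [].
by apply: incl_inj; rewrite !incl_conjN /conjL !mulgA invgK mulVg mul1g mulgVK.
Qed.

Lemma C2'_dom c' : C2' N K c' -> {in dom c', forall p, p.1 \in N \/ p.2 \in N}.
Proof.
move=> [s sN c'E] p pc'; apply: contrapT => pN; move: pc'.
rewrite mem_dom c'E raddf_sum big_seq big1 ?eqxx// => q /sN[g gN <-].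
rewrite /= coeffZ coeffU mul1r; case: eqP => [gp|]; last by rewrite mulr0.
by case: pN; rewrite -gp.
Qed.

(** The linear extension of [phi] is a left inverse of [chain_incl]; applied to [bd c'] it gives the
    sum of triangles. *)
Lemma filling_triangles c c' : bd c' = chain_incl c ->
  c = \sum_(p <- dom c') coeff p c' *: triangle p :> {freeg Nt / K}.
Proof.
move=> bc'; pose phis : {linear {freeg G / K} -> {freeg Nt / K}} :=
  fglift (fun g => << phi g >>).
have phisU g : phis << g >> = << phi g >>.
  by rewrite [LHS]liftU scale1r.
have -> : c = phis (chain_incl c).
  rewrite -[in RHS](freeg_sumE c) !linear_sum -[LHS]freeg_sumE; apply: eq_bigr => x _.
  rewrite /= /chain_incl liftU linearZ /= phisU phi_incl.
  by rewrite freegUZ mulr1.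
rewrite -bc' -[in LHS](freeg_sumE c') !linear_sum; apply: eq_bigr => p _.
rewrite /= /bd liftU linearZ /= linearD linearB /=.
by rewrite !phisU.
Qed.

End Triangles.

Lemma fgchange_triangle (G : groupType) (N : groupClosed G) (K L : nzRingType)
    (f : {rmorphism K -> L}) (phi : G -> subgrp N) p :
  fgchange f (triangle K phi p) = triangle L phi p.
Proof.
rewrite /triangle !fgchangeD !fgchangeU; congr (_ + _ + _).
by rewrite -scaleN1r fgchangeZ fgchangeU rmorphN1 scaleN1r.
Qed.

(** * The upper bound from a filling *)

Section SclUpperBound.
Variables (R : realType) (G : groupType) (N : groupClosed G).
Variable N_normal : is_normal N.
Local Notation Nt := (subgrp N).

Lemma scl_le_mono (r r' : R) (c : {freeg Nt / int}) :
  r <= r' -> scl_le r c -> scl_le r' c.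
Proof.
move=> rr' [C hC]; exists C => k; have [n nC cn] := hC k; exists n => //.
by rewrite (le_trans nC)// lerD2r ler_wpM2r.
Qed.

(** The retraction writes [z] as a real combination of triangles, which cost 1/2 each, and of power
    relations, which cost nothing. An integral combination for a multiple [M z] with nearby
    coefficients then proves the bound up to [e]. *)
Lemma scl_le_filling (z : mixed_chain N int) (h : mixed_chain N R) c' (e : R) :
  h \in @h_pred R G N -> C2' N R c' ->
  bd c' = chain_incl (val (mixed_change intr z + h)) ->
  0 < e -> scl_le (2^-1 * l1norm c' + e) (val z).
Proof.
move=> /asboolP[s sh hE] Cc' bc' e0.
have [phi [phi_incl phiMl phiMr]] := normal_retraction N_normal.
have triP p : p.1 \in N \/ p.2 \in N -> scl_le (2^-1 : R) (triangle int phi p).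
  move=> /(triangle_conj int phi_incl phiMl phiMr)[g [x [y ->]]].
  exact: scl_le_triangle.
(* A crude bound from an integral filling of [z], as [scl_le_div] demands. *)
have [r0 zr0] : exists r0 : R, scl_le r0 (val z).
  have /asboolP[d' Cd' bd'] := valP z.
  rewrite (filling_triangles phi_incl bd').
  exists (\sum_(p <- dom d') `|coeff p d'|%:~R * 2^-1).
  apply: scl_le_sum => // p pd; apply: scl_leZ => //.
  exact/triP/(C2'_dom Cd').
pose I : finType := ('I_(size (dom c')) + 'I_(size s))%type.
pose P (i : 'I_(size (dom c'))) := tnth (in_tuple (dom c')) i.
pose S (j : 'I_(size s)) := tnth (in_tuple s) j.
have SE j : exists xk : Nt * int,
    (S j).2 = << zpow xk.1 xk.2 >> - xk.2%:~R *: << xk.1 >>.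
  by have [x [k xkE]] := sh _ (mem_tnth j (in_tuple s)); exists (x, k).
have {SE}[xk SE] := choice SE.
pose w (i : I) : {freeg Nt / int} := match i with
  | inl i => triangle int phi (P i)
  | inr j => << zpow (xk j).1 (xk j).2 >> - (xk j).2 *: << (xk j).1 >>
  end.
pose a (i : I) : R := match i with
  | inl i => coeff (P i) c' | inr j => - (S j).1 end.
have aw : \sum_i a i *: fgchange intr (w i) = fgchange intr (val z).
  rewrite big_sumType /= [X in X + _](_ : _ =
      \sum_(p <- dom c') coeff p c' *: triangle R phi p); last first.
    rewrite [RHS]big_tnth.
    rewrite (eq_bigr (fun i => coeff (P i) c' *: triangle R phi (P i))).
      by [].
    by move=> i _; rewrite fgchange_triangle.
  rewrite -(filling_triangles phi_incl bc') [X in _ + X](_ : _ = - val h).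
    by rewrite raddfD /= addrK.
  rewrite hE -sumrN [RHS]big_tnth; apply: eq_bigr => j _; rewrite scaleNr -/(S j) SE.
  congr (- (_ *: _)); rewrite fgchangeD fgchangeU; congr (_ + _).
  by rewrite -scaleNr fgchangeZ fgchangeU rmorphN scaleNr.
pose n := size (dom c').
(* Each of the [n] triangle coefficients errs by at most this much relative to [M], and the errors
   are halved; [n.+1] allows for [n = 0]. *)
have e1 : 0 < 2 * e / n.+1%:R by rewrite divr_gt0 ?mulr_gt0.
have [M [A [M0 MzA Aa]]] := int_relation_approx e1 aw.
apply: (scl_le_div N_normal (M := M) _ zr0) => //.
rewrite MzA big_sumType /=; set T := (X in scl_le _ (X + _)).
set H := (X in scl_le _ (_ + X)).
have HA : scl_le (0 : R) H.
  rewrite [X in scl_le X _](_ : _ = \sum_(j < size s) 0); last by rewrite big1.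
  apply: scl_le_sum => // j _; rewrite -(mulr0 (`|A (inr j)|%:~R)).
  by apply: scl_leZ => //; exact: scl_le_power.
have TA : scl_le (\sum_(i < n) `|A (inl i)|%:~R * 2^-1 : R) T.
  apply: scl_le_sum => // i _; apply: scl_leZ => //; apply/triP/(C2'_dom Cc').
  exact: mem_tnth.
apply: scl_le_mono (scl_leD N_normal TA HA); rewrite addr0.
apply: (@le_trans _ _
  (\sum_(i < n) (M%:R * (`|a (inl i)| + 2 * e / n.+1%:R)) * 2^-1)).
  apply: ler_sum => i _; rewrite ler_wpM2r// intr_norm.
  rewrite mulrDr (le_trans _ (lerD (lexx _) (Aa (inl i))))//.
  rewrite -{1}(subrK (M%:R * a (inl i)) (A (inl i))%:~R) addrC.
  by rewrite (le_trans (ler_normD _ _))// normrM normr_nat.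
rewrite -mulr_suml -mulr_sumr -mulrA ler_wpM2l// big_split /=.
rewrite [X in (X + _) * _](_ : _ = l1norm c'); last first.
  by rewrite /l1norm [RHS]big_tnth.
rewrite sumr_const card_ord -(mulr_natr _ n).
suff : 2 * e / n.+1%:R * n%:R <= 2 * e.
  by move: (2 * e / n.+1%:R * n%:R) => X; lra.
by rewrite mulrAC ler_pdivrMr// ler_wpM2l ?ler_nat// mulr_ge0// ltW.
Qed.

End SclUpperBound.

Ltac freeg_ring :=
  apply/eqP/freeg_eqP => ?; rewrite !(coeffD, coeffN, coeffZ); ring.

Lemma val_mixed_change (G : groupType) (N : groupClosed G) (K L : nzRingType)
    (f : {rmorphism K -> L}) (c : mixed_chain N K) :
  val (mixed_change f c) = fgchange f (val c).
Proof. exact: SubK. Qed.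

(** * Norm estimates in the homogenized quotient *)

Section ChClass.
Variables (R : realType) (G : groupType) (N : groupClosed G).
Local Notation Nt := (subgrp N).
Implicit Types (m : mixed_chain N R) (c d : {freeg Nt / R}).

Lemma Ch_class_is_linear : linear (@Ch_class R G N).
Proof. by move=> a u v; rewrite /Ch_class linearP. Qed.
HB.instance Definition _ := GRing.isLinear.Build R (mixed_chain N R) (Ch R N)
  *:%R (@Ch_class R G N) Ch_class_is_linear.

Lemma Ch_class_surj q : exists m, Ch_class m = q.
Proof. by exists (quotrep q); exact: quotrepK. Qed.

Lemma Ch_norm_le m : `|Ch_class m| <= `|m|.
Proof. exact: qnorm_le. Qed.

Lemma Ch_norm_approx (q : Ch R N) e : 0 < e ->
  exists2 m, Ch_class m = q & `|m| < `|q| + e.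
Proof. exact: qnorm_approx. Qed.

Lemma Ch_class_eqP m m' : Ch_class m = Ch_class m' <->
  forall e, 0 < e -> exists2 h, h \in @h_pred R G N & `|m - m' - h| < e.
Proof.
by split=> [/quotpi_eqP/closurepP//|h]; apply/quotpi_eqP/closurepP.
Qed.

Lemma Ch_class_h m : m \in @h_pred R G N -> Ch_class m = 0.
Proof.
move=> hm; rewrite -(linear0 (@Ch_class R G N)); apply/Ch_class_eqP => e e0.
by exists m => //; rewrite subr0 subrr normr0.
Qed.

(** Carries membership in C_R(G, N) along with the bound, so that estimates are combined as plain
    chains on [N]. *)
Definition ch_le c (r : R) :=
  exists2 m : mixed_chain N R, val m = c & `|Ch_class m| <= r.

Lemma ch_le_mono c r r' : r <= r' -> ch_le c r -> ch_le c r'.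
Proof. by move=> rr' [m mc mr]; exists m => //; exact: le_trans rr'. Qed.

Lemma ch_leP m r : ch_le (val m) r -> `|Ch_class m| <= r.
Proof. by move=> [m' /val_inj ->]. Qed.

Lemma ch_le0 : ch_le 0 0.
Proof. by exists 0; rewrite ?linear0 ?normr0. Qed.

Lemma ch_leD c d r s : ch_le c r -> ch_le d s -> ch_le (c + d) (r + s).
Proof.
move=> [m <- mr] [n <- ns]; exists (m + n); rewrite ?linearD//.
by rewrite (le_trans (ler_normD _ _))// lerD.
Qed.

Lemma ch_leZ a c r : ch_le c r -> ch_le (a *: c) (`|a| * r).
Proof.
move=> [m <- mr]; exists (a *: m); rewrite ?linearZ//.
by rewrite normrZ ler_wpM2l.
Qed.

Lemma ch_leN c r : ch_le c r -> ch_le (- c) r.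
Proof. by move=> /(ch_leZ (-1)); rewrite scaleN1r normrN1 mul1r. Qed.

Lemma ch_le_filling c (c' : {freeg (G * G)%type / R}) :
  C2' N R c' -> bd c' = chain_incl c ->
  ch_le c (l1norm c').
Proof.
move=> Cc' bc'; have cN : c \in mixed_pred N R by apply/asboolP; exists c'.
exists (Sub c cN : mixed_chain N R); first exact: SubK.
by rewrite (le_trans (Ch_norm_le _))//; apply: mixed_norm_le; split; rewrite ?SubK.
Qed.

Lemma C2'_lin a (c' d' : {freeg (G * G)%type / R}) :
  C2' N R c' -> C2' N R d' -> C2' N R (a *: c' + d').
Proof. exact: lspan_linear. Qed.

Lemma C2'U p : p.1 \in N \/ p.2 \in N -> C2' N R << p >>.
Proof. by move=> pN; apply: sub_lspan; exists p. Qed.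

Lemma bdU (p : G * G) : bd << p >> =
  << p.2 >> - << (p.1 * p.2)%g >> + << p.1 >> :> {freeg G / R}.
Proof. by rewrite /bd liftU scale1r. Qed.

Lemma chain_inclU (x : Nt) :
  chain_incl << x >> = << subgrp_incl x >> :> {freeg G / R}.
Proof. by rewrite /chain_incl liftU scale1r. Qed.

Lemma ch_le_mul (x y : Nt) : ch_le (<< x >> - << (x * y)%g >> + << y >>) 1.
Proof.
rewrite -[X in ch_le _ X](l1normU R (subgrp_incl x, subgrp_incl y)).
apply: ch_le_filling.
  by apply: C2'U; left; exact: (valP x).
rewrite bdU !linearD linearN /= !chain_inclU inclM.
freeg_ring.
Qed.

(** The class is zero because the chain is a generator of h(G, N); the work lies in its membership
    in C_R(G, N), by telescoping boundaries of pairs [(x, zpow x j)]. *)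
Lemma ch_le_power (x : Nt) (k : int) :
  ch_le (<< zpow x k >> - k%:~R *: << x >>) 0.
Proof.
set D := fun j : int => << zpow x j >> - j%:~R *: << x >> : {freeg Nt / R}.
have DS j : D (1 + j) = D j - (<< x >> - << (x * zpow x j)%g >> + << zpow x j >>).
  by rewrite /D zpowS rmorphD /=; freeg_ring.
have [m mD] : exists m : mixed_chain N R, val m = D k.
  have tri j : exists m : mixed_chain N R,
      val m = << x >> - << (x * zpow x j)%g >> + << zpow x j >>.
    by have [m mE _] := ch_le_mul x (zpow x j); exists m.
  have D0 : exists m : mixed_chain N R, val m = D 0.
    by have [m mE] := tri 0; exists m; rewrite mE /D mulg1 subrr add0r scale0r subr0.
  have Dn (n : nat) : (exists m : mixed_chain N R, val m = D n%:Z) /\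
      (exists m : mixed_chain N R, val m = D (- n%:Z)).
    elim: n => [|n [[m mn] [m' mn']]]; first by rewrite oppr0.
    split.
      have [t tE] := tri n%:Z; exists (m - t).
      by rewrite -add1n PoszD DS -mn -tE linearB.
    have [t tE] := tri (- n.+1%:Z); exists (m' + t).
    have -> : D (- n.+1%:Z) = D (1 + - n.+1%:Z) + val t.
      by rewrite DS tE subrK.
    have -> : (1 + - n.+1%:Z = - n%:Z)%R by rewrite -add1n PoszD opprD addNKr.
    by rewrite linearD -mn'.
  by case: k => n; [exact: (Dn n).1|rewrite NegzE; exact: (Dn n.+1).2].
exists m => //; rewrite Ch_class_h ?normr0//; apply/asboolP; rewrite mD.
by apply: sub_lspan; exists x, k.
Qed.

Lemma ch_le_inv (x : Nt) : ch_le (<< x^-1%g >> + << x >>) 0.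
Proof. by have := ch_le_power x (-1); rewrite scaleN1r opprK. Qed.

Lemma ch_le_small c C : (forall n : nat, ch_le (n%:R *: c) C) -> ch_le c 0.
Proof.
move=> cC; have [m mc _] := cC 1%N; rewrite scale1r in mc; exists m => //.
rewrite leNgt; apply/negP => m0.
have /= mC := truncnS_gt (C / `|Ch_class m|); set n := (Num.truncn _).+1 in mC.
have : ch_le (val (n%:R *: m)) C by rewrite linearZ /= mc; exact: cC.
move=> /ch_leP; rewrite linearZ /= normrZ normr_nat => h.
by move: mC; rewrite ltr_pdivrMr// ltNge h.
Qed.

Variable N_normal : is_normal N.
Local Notation conjN := (conjN N_normal).

(** Since [g x g^-1 g = g x], the boundaries of [(g, x)] and [(g x g^-1, g)] share their middle
    term, and in their difference the terms [g] cancel as well. *)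
Lemma ch_le_conj_bounded g x : ch_le (<< x >> - << conjN g x >>) 2.
Proof.
set t := << (g, subgrp_incl x) >> : {freeg (G * G)%type / R}.
set u := << (subgrp_incl (conjN g x), g) >> : {freeg (G * G)%type / R}.
have tC : C2' N R t by apply: C2'U; right; exact: (valP x).
have uC : C2' N R u by apply: C2'U; left; exact: (valP (conjN g x)).
have h := C2'_lin (-1) uC tC; apply: ch_le_mono (ch_le_filling h _).
  rewrite (le_trans (l1normD _ _))// l1normZ !l1normU normrN1 mulr1.
  by rewrite -(natrD R 1 1).
rewrite linearD linearZ linearB /= !bdU !chain_inclU /=.
have -> : (subgrp_incl (conjN g x) * g = g * subgrp_incl x)%g.
  by rewrite incl_conjN /conjL mulgVK.
freeg_ring.
Qed.

Lemma ch_le_conj g x : ch_le (<< x >> - << conjN g x >>) 0.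
Proof.
apply: (@ch_le_small _ 2) => n.
have cn : zpow (conjN g x) n = conjN g (zpow x n).
  by apply: incl_inj; rewrite incl_zpow !incl_conjN incl_zpow zpow_conj.
have -> : n%:R *: (<< x >> - << conjN g x >>) =
    (<< zpow x n >> - << conjN g (zpow x n) >>) -
    (<< zpow x n >> - n%:R *: << x >>) +
    (<< zpow (conjN g x) n >> - n%:R *: << conjN g x >>) :> {freeg Nt / R}.
  by rewrite cn; freeg_ring.
apply: (@ch_le_mono _ (2 + 0 + 0)); first by rewrite !addr0.
apply: ch_leD; last exact: (ch_le_power _ n).
apply: ch_leD; first exact: ch_le_conj_bounded.
exact/ch_leN/(ch_le_power _ n).
Qed.

End ChClass.

(** * The limit defining scl of an expression *)

Section SclFormula.
Variables (R : realType) (G : groupType) (N : groupClosed G).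
Variable N_normal : is_normal N.
Local Notation Nt := (subgrp N).
Local Notation conjN := (conjN N_normal).
Local Notation ch_le := (@ch_le R G N).

Lemma ch_le_sum0 I (s : seq I) (F : I -> {freeg Nt / R}) :
  (forall i, ch_le (F i) 0) -> ch_le (\sum_(i <- s) F i) 0.
Proof.
move=> F0; elim: s => [|i s IHs]; first by rewrite big_nil; exact: ch_le0.
by rewrite big_cons -[X in ch_le _ X]addr0; exact: ch_leD.
Qed.

Lemma ch_le_one : ch_le << 1%g >> 0.
Proof. by have := ch_le_power R (1%g : Nt) 0; rewrite scale0r subr0. Qed.

Lemma ch_le_prod (s : seq Nt) :
  ch_le (<< (\prod_(x <- s) x)%g >> - \sum_(x <- s) << x >>) (size s)%:R.
Proof.
elim: s => [|x s IHs]; first by rewrite !big_nil subr0; exact: ch_le_one.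
rewrite !big_cons /= -natr1; set P := (\prod_(i <- s) i)%g in IHs *.
have := ch_leD IHs (ch_leN (ch_le_mul R x P)); congr ch_le; freeg_ring.
Qed.

(** Of the 2 per commutator, one splits it from the remaining product [P] and one splits
    [conjN g x * x^-1]; what is left, [x^-1 + x] and [x - g x g^-1], has norm zero. *)
Lemma ch_le_ncomm n y : ncomm n y -> ch_le << y >> (n%:R *+ 2).
Proof.
move=> [s sn ys].
have -> : y = (\prod_(p <- s) (conjN p.1 p.2 * p.2^-1))%g.
  apply: incl_inj; rewrite ys incl_prod; apply: eq_bigr => p _.
  by rewrite inclM incl_conjN inclV.
apply: (@ch_le_mono _ _ _ _ ((size s)%:R *+ 2)); first by rewrite lerMn2r ler_nat.
elim: s {sn ys} => [|p s IHs]; first by rewrite big_nil mul0rn; exact: ch_le_one.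
rewrite big_cons /= -natr1 mulrnDl; set P := (\prod_(i <- s) _)%g in IHs *.
have h1 := ch_leN (ch_le_mul R (conjN p.1 p.2 * p.2^-1)%g P).
have h2 := ch_leN (ch_le_mul R (conjN p.1 p.2) (p.2^-1)%g).
have h3 := ch_leD (ch_leN (ch_le_conj R N_normal p.1 p.2)) (ch_le_inv R p.2).
have := ch_leD IHs (ch_leD (ch_leD h1 h2) h3); rewrite !addr0.
by congr ch_le; freeg_ring.
Qed.

(** Power relations and conjugations vanish in the quotient. The error comes from splitting the
    product into its factors, whose number does not depend on [k]. *)
Lemma scl_lower_bound (z : mixed_chain N int) xs ys k ab (s : seq (G * Nt)) :
  expresses z (xs, ys) ->
  unzip2 ab.1 = [seq (x ^+ k)%g | x <- xs] ->
  unzip2 ab.2 = [seq (y ^+ k)%g | y <- ys] ->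
  ((\prod_(p <- ab.1) conjL p.1 (subgrp_incl p.2)) *
    (\prod_(p <- ab.2) (conjL p.1 (subgrp_incl p.2))^-1) =
    \prod_(p <- s) commL p.1 (subgrp_incl p.2))%g ->
  k%:R * `|Ch_class (mixed_change (intr : {rmorphism int -> R}) z)| <=
    (size s)%:R *+ 2 + (size xs + size ys)%:R.
Proof.
case: ab => a b /= zE axs bys abs.
pose A := [seq conjN p.1 p.2 | p <- a].
pose B := [seq (conjN p.1 p.2)^-1%g | p <- b].
pose q : Nt := (\prod_(x <- A ++ B) x)%g.
have qn : ncomm (size s) q.
  exists s => //; rewrite -abs /q big_cat !big_map inclM !incl_prod.
  by congr (_ * _)%g; apply: eq_bigr => p _; rewrite ?inclV incl_conjN.
have sA : size A = size xs.
  by rewrite size_map -(size_map snd) -/(unzip2 a) axs size_map.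
have sB : size B = size ys.
  by rewrite size_map -(size_map snd) -/(unzip2 b) bys size_map.
have powE t : ch_le (\sum_(x <- t) (<< (x ^+ k)%g >> - k%:R *: << x >>)) 0.
  by apply: ch_le_sum0 => x; exact: (ch_le_power R x k).
have h1 : ch_le (\sum_(p <- a) (<< p.2 >> - << conjN p.1 p.2 >>)) 0.
  by apply: ch_le_sum0 => p; exact: ch_le_conj.
have h2 : ch_le (\sum_(p <- b) (<< p.2 >> - << conjN p.1 p.2 >>)) 0.
  by apply: ch_le_sum0 => p; exact: ch_le_conj.
have h3 : ch_le
    (\sum_(p <- b) (<< (conjN p.1 p.2)^-1%g >> + << conjN p.1 p.2 >>)) 0.
  by apply: ch_le_sum0 => p; exact: ch_le_inv.
have := ch_leD (ch_leD (ch_leD (ch_le_ncomm qn) (ch_leN (ch_le_prod (A ++ B))))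
  (ch_leD h1 (ch_leN (ch_leD h2 h3))))
  (ch_leD (ch_leN (powE xs)) (powE ys)).
rewrite !addr0 size_cat sA sB -/q => h.
rewrite -[k%:R in leLHS]normr_nat -normrZ -linearZ /=; apply: ch_leP.
move: h; congr ch_le.
rewrite [RHS](_ : _ = k%:R *: fgchange intr (val z)); last by rewrite linearZ.
rewrite zE /= fgchangeD.
have fgN c : fgchange (intr : {rmorphism int -> R}) (- c) =
    - fgchange intr c :> {freeg Nt / R}.
  by rewrite -scaleN1r fgchangeZ rmorphN1 scaleN1r.
have fgs (t : seq Nt) :
    fgchange (intr : {rmorphism int -> R}) (\sum_(x <- t) << x >>) =
    \sum_(x <- t) << x >>.
  by rewrite fgchange_sum; apply: eq_bigr => x _; exact: fgchangeU.
rewrite fgN !fgs.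
rewrite big_cat /= !big_map !sumrB !big_split /= -!scaler_sumr.
have -> : \sum_(p <- a) << p.2 >> = \sum_(x <- xs) << (x ^+ k)%g >> :> {freeg Nt / R}.
  by rewrite -(big_map snd xpredT (fun x => << x >>)) -/(unzip2 a) axs big_map.
have -> : \sum_(p <- b) << p.2 >> = \sum_(x <- ys) << (x ^+ k)%g >> :> {freeg Nt / R}.
  by rewrite -(big_map snd xpredT (fun x => << x >>)) -/(unzip2 b) bys big_map.
freeg_ring.
Qed.

Lemma scl_upper_bound (z : mixed_chain N int) (e : R) : 0 < e ->
  scl_le (2^-1 * `|Ch_class (mixed_change (intr : {rmorphism int -> R}) z)| + e)
    (val z).
Proof.
move=> e0; set zR := mixed_change _ z.
(* The choices of [m], [h] and [c'] lose [e / 2] each, that is [3 e / 4] after halving;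
   [scl_le_filling] is given the remaining [e / 4]. *)
have e8 : 0 < e / 2 by rewrite divr_gt0.
have [m mz mn] := Ch_norm_approx (Ch_class zR) e8.
have [h hh mh] := (Ch_class_eqP _ _).1 mz _ e8.
have [c' [Cc' bc'] cn] := mixed_norm_approx (zR + h) e8.
apply: scl_le_mono (scl_le_filling N_normal hh Cc' bc' (divr_gt0 e8 (ltr0n R 2))).
have : `|zR + h| <= `|m| + `|m - zR - h|.
  have -> : zR + h = m - (m - zR - h) by rewrite -addrA -opprD subKr.
  exact: ler_normB.
rewrite -[`|zR + h|]/(mixed_norm _); lra.
Qed.

Lemma scl_expr_half_norm (z : mixed_chain N int) xs ys :
  expresses z (xs, ys) ->
  scl_expr R xs ys =
    2^-1 * `|Ch_class (mixed_change (intr : {rmorphism int -> R}) z)|.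
Proof.
move=> zE; set L := `|_|.
pose u k := cl_expr R [seq (x ^+ k)%g | x <- xs] [seq (y ^+ k)%g | y <- ys].
pose D : R := 2^-1 * (size xs + size ys)%:R.
have lower k : ((2^-1 * L * k%:R - D)%:E <= u k)%E.
  apply: le_ereal_inf_tmp => _ [[a b] [axs bys] <-].
  apply: le_ereal_inf_tmp => _ [s sE <-]; rewrite lee_fin.
  have := scl_lower_bound zE axs bys sE; rewrite -/L mulr2n /D; lra.
have upper e : 0 < e -> exists C : nat, forall k,
    (u k <= (2^-1 * L * k%:R + e * k%:R + C%:R)%:E)%E.
  move=> e0; have [C1 hC1] := scl_upper_bound z e0.
  have [C2 hC2] := cprod_expr N_normal xs ys.
  exists (C2 + C1)%N => k; have [n nC cn] := hC1 k.
  have [s sn sE] : ncomm (C2 + n) (expr_prod [seq (x ^+ k)%g | x <- xs]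
      [seq (y ^+ k)%g | y <- ys]).
    apply: (ncomm_cnear (hC2 k)).
    by move: cn; rewrite zE.
  apply: (@le_trans _ _ ((size s)%:R%:E)); last first.
    rewrite lee_fin (@le_trans _ _ ((C2 + n)%:R))// ?ler_nat//.
    by move: nC; rewrite !natrD -/L; lra.
  have pairK (t : seq Nt) : unzip2 [seq (1%g : G, x) | x <- t] = t.
    by rewrite /unzip2 -map_comp map_id_in.
  have conj1 (x : G) : conjL 1%g x = x by rewrite /conjL mul1g invg1 mulg1.
  (* Trivial conjugators are one admissible choice, which suffices for an upper bound. *)
  apply: ge_ereal_inf; eexists.
    exists ([seq (1%g, x) | x <- [seq (x ^+ k)%g | x <- xs]],
            [seq (1%g, y) | y <- [seq (y ^+ k)%g | y <- ys]]).
      by split; exact: pairK.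
    by [].
  apply: ereal_inf_lbound; exists s => //=.
  rewrite -sE /expr_prod inclM !incl_prod ![in LHS]big_map ![in RHS]big_map.
  congr (_ * _)%g; apply: eq_bigr => x _; first by rewrite conj1.
  by rewrite inclV conj1.
(* Finiteness matters because [scl_expr] applies [fine], which turns infinite values into 0. *)
have ufin k : u k \is a fin_num.
  have [C hC] := upper 1 ltr01; rewrite fin_numE.
  apply/andP; split; apply/eqP => uk.
    by have := lower k; rewrite uk.
  by have := hC k; rewrite uk.
apply: cvg_lim => //; apply/cvgrPdist_le => e e0.
have e2 : 0 < e / 2 by rewrite divr_gt0.
have [C hC] := upper _ e2.
near=> k.
have k0 : 0 < k%:R :> R by rewrite ltr0n; near: k; exists 1%N.
(* From here on the constants [D + C] amount to at most [e k / 2]; together with the slope [e / 2]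
   of the upper bound the error is at most [e k]. *)
have kbig : (D + C%:R) * 2 / e <= k%:R :> R.
  by near: k; exact: nbhs_infty_ger.
have D0 : 0 <= D by rewrite mulr_ge0.
have C0 : 0 <= C%:R :> R by [].
have := lower k; have := hC k; rewrite -/(u k).
rewrite -{1 2}(fineK (ufin k)) !lee_fin; set v := fine _ => vup vlow.
have -> : 2^-1 * L - v / k%:R = (2^-1 * L * k%:R - v) / k%:R.
  by rewrite mulrBl mulfK// gt_eqF.
rewrite normrM normfV normr_nat ler_pdivrMr//.
move: kbig; rewrite ler_pdivrMr// => kbig.
by rewrite ler_norml; apply/andP; split; nra.
Unshelve. all: by end_near.
Qed.

End SclFormula.

(** * Clearing denominators of mixed chains *)

Section CoefficientChange.
Variables (G : groupType) (N : groupClosed G).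
Local Notation Nt := (subgrp N).

Lemma fgchange_bd (K L : nzRingType) (f : {rmorphism K -> L})
    (c : {freeg (G * G)%type / K}) : fgchange f (bd c) = bd (fgchange f c).
Proof.
apply: fgchange_fglift => g.
by rewrite !fgchangeD !fgchangeU -scaleN1r fgchangeZ fgchangeU rmorphN1 scaleN1r.
Qed.

Lemma fgchange_chain_incl (K L : nzRingType) (f : {rmorphism K -> L})
    (c : {freeg Nt / K}) : fgchange f (chain_incl c) = chain_incl (fgchange f c).
Proof. by apply: fgchange_fglift => x; rewrite fgchangeU. Qed.

Lemma fgchange_inj (T : choiceType) (K L : nzRingType) (f : {rmorphism K -> L}) :
  injective f -> injective (@fgchange K L f T).
Proof.
move=> fI c d cd; apply/eqP/freeg_eqP => x; apply: fI.
by rewrite -!coeff_fgchange cd.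
Qed.

Lemma C2'_domP (K : nzRingType) (c' : {freeg (G * G)%type / K}) :
  {in dom c', forall p, p.1 \in N \/ p.2 \in N} -> C2' N K c'.
Proof.
move=> cN; exists [seq (coeff p c', << p >>) | p <- dom c'].
  by move=> _ /mapP[p /cN pN ->]; exists p.
rewrite big_map -[LHS]freeg_sumE; apply: eq_bigr => p _.
by rewrite /= freegUZ mulr1.
Qed.

(** The inclusion of supports lets a multiple of a filling stay on the admissible pairs. *)
Lemma int_multiple (T : choiceType) (c : {freeg T / rat}) :
  exists M (z : {freeg T / int}), [/\ (0 < M)%N, {subset dom z <= dom c} &
    fgchange (intr : {rmorphism int -> rat}) z = M%:R *: c].
Proof.
have [M M0 /choice[A hA]] :=
  common_denominator (fun i : 'I_(size (dom c)) =>
    coeff (tnth (in_tuple (dom c)) i) c).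
pose z : {freeg T / int} := \sum_i << A i *g tnth (in_tuple (dom c)) i >>.
have zE : fgchange (intr : {rmorphism int -> rat}) z = M%:R *: c.
  rewrite fgchange_sum -[in RHS](freeg_sumE c) scaler_sumr [RHS]big_tnth.
  apply: eq_bigr => i _.
  by rewrite -[A i]mulr1 -freegUZ fgchangeZ fgchangeU !freegUZ mulr1 [LHS]/= hA.
exists M, z; split=> // t; rewrite !mem_dom.
apply: contra => /eqP ct; apply/eqP; apply: (intr_inj (R := rat)).
by rewrite -coeff_fgchange zE coeffZ ct mulr0.
Qed.

(** Denominators are cleared in a filling and not only in [c], since an integral mixed chain needs
    an integral filling; the coefficients of the multiple are read off the boundary [bd z']. *)
Lemma mixed_int_multiple (c : mixed_chain N rat) :
  exists M (z : mixed_chain N int), (0 < M)%N /\ mixed_change intr z = M%:R *: c.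
Proof.
have /asboolP[c' Cc' bc'] := valP c.
have [M [z' [M0 zc' zE]]] := int_multiple c'.
pose z : {freeg Nt / int} :=
  \sum_(x <- dom (val c)) << coeff (subgrp_incl x) (bd z') *g x >>.
have zcE : fgchange (intr : {rmorphism int -> rat}) z = M%:R *: val c.
  rewrite fgchange_sum -[in RHS](freeg_sumE (val c)) scaler_sumr.
  apply: eq_bigr => x _; rewrite -[X in << X *g _ >>]mulr1 -freegUZ fgchangeZ.
  rewrite fgchangeU freegUZ [RHS]freegUZ mulr1; congr (<< _ *g x >>).
  rewrite -coeff_fgchange fgchange_bd zE linearZ /= bc' coeffZ.
  by rewrite coeff_chain_incl.
have zN : z \in mixed_pred N int.
  apply/asboolP; exists z'.
    by apply: C2'_domP => p /zc'; exact: (C2'_dom Cc').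
  apply: (fgchange_inj (f := intr : {rmorphism int -> rat})) => [|].
    exact: intr_inj.
  by rewrite fgchange_bd fgchange_chain_incl zcE zE !linearZ /= bc'.
exists M, (Sub z zN); split=> //; apply: val_inj.
by rewrite val_mixed_change SubK zcE linearZ.
Qed.

Lemma int_chain_expr (z : {freeg Nt / int}) : exists e : seq Nt * seq Nt,
  z = \sum_(x <- e.1) << x >> - \sum_(y <- e.2) << y >>.
Proof.
pose P (c : {freeg Nt / int}) := exists e : seq Nt * seq Nt,
  c = \sum_(x <- e.1) << x >> - \sum_(y <- e.2) << y >>.
have P0 : P 0 by exists ([::], [::]); rewrite !big_nil subr0.
have PD c d : P c -> P d -> P (c + d).
  move=> [[a b] ->] [[a' b'] ->]; exists (a ++ a', b ++ b').
  by rewrite /= !big_cat /= opprD addrACA.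
have PN c : P c -> P (- c) by move=> [[a b] ->]; exists (b, a); rewrite opprB.
have PZ (m : int) x : P << m *g x >>.
  have Pn (n : nat) : P << n%:Z *g x >>.
    elim: n => [|n IHn]; first by rewrite freegU0.
    rewrite -addn1 PoszD -freegUD; apply: PD => //.
    by exists ([:: x], [::]); rewrite big_seq1 big_nil subr0.
  by case: m => n //; rewrite NegzE -freegUN; exact: PN.
by change (P z); rewrite -[z]freeg_sumE; apply: big_ind.
Qed.

End CoefficientChange.

(** * The formula for rational chains and their density *)

Section SclOnRationalChains.
Variables (R : realType) (G : groupType) (N : groupClosed G).
Variable N_normal : is_normal N.
Local Notation Nt := (subgrp N).

Lemma sclZ_half_norm (z : mixed_chain N int) : sclZ R z =
  2^-1 * `|Ch_class (mixed_change (intr : {rmorphism int -> R}) z)|.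
Proof.
(* [xget] returns its default only if no expression exists, which [int_chain_expr] excludes. *)
rewrite /sclZ; case: xgetP => [e _ zE|/(_ _)].
  by apply: scl_expr_half_norm => //; rewrite -surjective_pairing.
by have [e zE] := int_chain_expr (val z) => /(_ e).
Qed.

Lemma scl_half_norm (c : mixed_chain N rat) :
  scl R c = 2^-1 * `|ChQ_class R c|.
Proof.
rewrite /scl; case: xgetP => [[k z] _ /= [k0 zE]|]; last first.
  by have [M [z [M0 zE]]] := mixed_int_multiple c => /(_ (M, z)) [].
have kR : (k%:R : R) != 0 by rewrite pnatr_eq0 -lt0n.
rewrite sclZ_half_norm.
have -> : mixed_change intr z = k%:R *: mixed_change (ratr : {rmorphism rat -> R}) c.
  apply: val_inj; rewrite linearZ; apply/eqP/freeg_eqP => x.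
  rewrite coeffZ [LHS]coeff_fgchange [X in _ * X]coeff_fgchange /=.
  have := congr1 (fun m => ratr (coeff x (val m)) : R) zE.
  rewrite /= [coeff x (fgchange _ _)]coeff_fgchange /= ratr_int => ->.
  by rewrite coeffZ rmorphM rmorph_nat.
by rewrite linearZ /= normrZ normr_nat mulrCA [k%:R * _]mulrC mulfK.
Qed.

Lemma l1norm_sum (T : choiceType) (I : Type) (s : seq I) (a : I -> R) (p : I -> T) :
  l1norm (\sum_(i <- s) a i *: << p i >>) <= \sum_(i <- s) `|a i|.
Proof.
elim: s => [|i s IHs]; first by rewrite !big_nil l1norm0.
rewrite !big_cons (le_trans (l1normD _ _))// lerD//.
by rewrite l1normZ l1normU mulr1.
Qed.

(** A real filling is a linear relation between boundaries of pairs and basis elements, all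
    integral. A nearby rational relation is a rational mixed chain with its own filling, and the
    difference of the two fillings has small l1-norm. *)
Lemma ChQ_dense (q : Ch R N) (e : R) : 0 < e ->
  exists c : mixed_chain N rat, `|q - ChQ_class R c| <= e.
Proof.
move=> e0; have [m <-] := Ch_class_surj q.
have /asboolP[c' Cc' bc'] := valP m.
set n := size (dom c'); set n' := size (dom (val m)).
pose P (i : 'I_n) := tnth (in_tuple (dom c')) i.
pose X (j : 'I_n') := tnth (in_tuple (dom (val m))) j.
pose w (i : 'I_n + 'I_n') : {freeg G / int} := match i with
  | inl i => bd << P i >> | inr j => << subgrp_incl (X j) >> end.
pose a (i : 'I_n + 'I_n') : R := match i with
  | inl i => coeff (P i) c' | inr j => - coeff (X j) (val m) end.
have c'E : c' = \sum_(i < n) coeff (P i) c' *: << P i >>.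
  rewrite -[LHS]freeg_sumE big_tnth; apply: eq_bigr => i _.
  by rewrite freegUZ mulr1.
have mE : val m = \sum_(j < n') coeff (X j) (val m) *: << X j >>.
  rewrite -[LHS]freeg_sumE big_tnth; apply: eq_bigr => i _.
  by rewrite freegUZ mulr1.
have aw : \sum_i a i *: fgchange intr (w i) = fgchange intr 0.
  rewrite fgchange0 big_sumType /=.
  have -> : \sum_(i < n) coeff (P i) c' *: fgchange intr (bd << P i >>) = bd c'.
    rewrite [in RHS]c'E linear_sum; apply: eq_bigr => i _.
    by rewrite fgchange_bd fgchangeU linearZ.
  rewrite bc' [in chain_incl _]mE linear_sum -big_split big1//= => j _.
  by rewrite fgchangeU linearZ /= chain_inclU scaleNr subrr.
have e1 : 0 < e / n.+1%:R by rewrite divr_gt0.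
have [M [A [M0 MA Aa]]] := int_relation_approx e1 aw.
pose z' : {freeg (G * G)%type / int} := \sum_(i < n) A (inl i) *: << P i >>.
pose z : {freeg Nt / int} := - \sum_(j < n') A (inr j) *: << X j >>.
have zz' : bd z' = chain_incl z.
  move: MA; rewrite scaler0 big_sumType /= => /esym /eqP; rewrite addr_eq0 => /eqP.
  have -> : bd z' = \sum_(i < n) A (inl i) *: bd << P i >>.
    by rewrite linear_sum; apply: eq_bigr => i _; rewrite linearZ.
  move=> ->; rewrite /z linearN; congr (- _); rewrite linear_sum.
  by apply: eq_bigr => j _; rewrite linearZ /= /chain_incl liftU scale1r.
have zC : C2' N int z'.
  apply: C2'_domP => p; rewrite mem_dom raddf_sum => zp.
  apply: contrapT => pN; move: zp; rewrite big1 ?eqxx// => i _.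
  rewrite /= coeffZ coeffU mul1r; case: eqP => [pE|]; last by rewrite mulr0.
  by case: pN; rewrite -pE; apply: (C2'_dom Cc'); exact: mem_tnth.
have zN : z \in mixed_pred N int by apply/asboolP; exists z'.
have MR : (M%:R : R) != 0 by rewrite pnatr_eq0 -lt0n.
exists (M%:R^-1 *: mixed_change (intr : {rmorphism int -> rat}) (Sub z zN)).
rewrite /ChQ_class -linearB /=; apply: ch_leP.
pose d' := c' - M%:R^-1 *: fgchange (intr : {rmorphism int -> R}) z'.
have d'E : d' = \sum_(i < n) (coeff (P i) c' - M%:R^-1 * (A (inl i))%:~R) *: << P i >>.
  rewrite /d' [in LHS]c'E fgchange_sum scaler_sumr -sumrB; apply: eq_bigr => i _.
  by rewrite fgchangeZ fgchangeU scalerBl scalerA.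
have fE : val (mixed_change (ratr : {rmorphism rat -> R})
    (M%:R^-1 *: mixed_change (intr : {rmorphism int -> rat}) (Sub z zN))) =
    M%:R^-1 *: fgchange (intr : {rmorphism int -> R}) z.
  rewrite val_mixed_change linearZ fgchangeZ /= fmorphV rmorph_nat; congr (_ *: _).
  apply/eqP/freeg_eqP => x; rewrite !coeff_fgchange /=.
  by rewrite ratr_int.
apply: (@ch_le_mono _ _ _ _ (l1norm d')); last first.
  apply: ch_le_filling.
    rewrite -[d']add0r /d' addrC -[c']scale1r.
    have zCR : C2' N R (fgchange (intr : {rmorphism int -> R}) z').
      apply: C2'_domP => p; rewrite mem_dom coeff_fgchange => zp.
      apply: (C2'_dom zC); rewrite mem_dom; apply: contra zp => /eqP ->.
      by rewrite rmorph0.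
    rewrite -scaleNr addr0 scale1r addrC; exact: C2'_lin.
  rewrite [chain_incl _](_ : _ = chain_incl (val m - M%:R^-1 *: fgchange intr z)).
    rewrite /d' linearB linearZ /= bc' -fgchange_bd zz' fgchange_chain_incl.
    by rewrite linearB; congr (_ - _); rewrite linearZ.
  by congr chain_incl; rewrite -fE; exact: linearB.
rewrite d'E (le_trans (l1norm_sum _ _ _))//.
apply: (@le_trans _ _ (\sum_(i < n) e / n.+1%:R)).
  apply: ler_sum => i _; have := Aa (inl i); rewrite distrC /= => h.
  rewrite -(ler_pM2l (x := M%:R)) ?ltr0n// (le_trans _ h)//.
  by rewrite -{1}[M%:R]normr_nat -normrM mulrBr mulVKf.
rewrite sumr_const card_ord -(mulr_natr _ n) mulrAC ler_pdivrMr//.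
by rewrite ler_wpM2l ?(ltW e0)// ler_nat.
Qed.

End SclOnRationalChains.

(** * Linear projections onto subspaces *)

Section LinearExtension.
Variables (K : fieldType) (V : lmodType K) (S : submodClosed V).

(* The projection onto [S] along a subset maximal among the subspaces that meet
   [S] trivially. *)
Lemma linear_projection :
  exists p : {linear V -> V}, (forall v, p v \in S) /\ {in S, p =1 id}.
Proof.
pose Q (A : set V) := (forall a u v, A u -> A v -> A (a *: u + v)) /\
  (forall v, A v -> v \in S -> v = 0).
have [A [[Alin A0S] Amax]] : exists A, Q A /\ forall B, A `<` B -> ~ Q B.
  apply: Zorn_bigcup => F FQ Ftot; split=> [a u v [X FX Xu] [Y FY Yv]|v [X FX Xv]].
    have [XY|YX] := Ftot _ _ FX FY.
      by exists Y => //; apply: (FQ _ FY).1 => //; exact: XY.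
    by exists X => //; apply: (FQ _ FX).1 => //; exact: YX.
  exact: (FQ _ FX).2.
(* [Q] admits the empty set, which arises as the union of the empty chain, so [0] lies in [A] only
   by maximality. *)
have A0 : A 0.
  apply: contrapT => nA0; pose B := [set v | A v \/ v = 0].
  case: (Amax B).
    by split=> [v Av|BA]; [left|apply/nA0/BA; right].
  split=> [a u v [Au|->] [Av|->]|v [Av|->]//]; last exact: A0S.
  - by left; exact: Alin.
  - left; rewrite addr0 -[u]scale1r scalerA mulr1.
    by have := Alin (a - 1) _ _ Au Au; rewrite -{2}[u]scale1r -scalerDl subrK.
  - by left; rewrite scaler0 add0r.
  - by right; rewrite scaler0 addr0.
have AZ a v : A v -> A (a *: v) by move=> Av; rewrite -[_ *: _]addr0; exact: Alin.
(* Otherwise adjoining the line through [v] to [A] would contradict maximality. *)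
have dec v : exists s, s \in S /\ A (v - s).
  apply: contrapT => nv.
  pose B := [set w | exists t k, A t /\ w = t + k *: v].
  case: (Amax B).
    split=> [t At|BA]; first by exists t, 0; rewrite scale0r addr0.
    apply: nv; exists 0; rewrite rpred0 subr0; split=> //; apply: BA.
    by exists 0, 1; rewrite scale1r add0r.
  split=> [a _ _ [t [k [At ->]]] [t' [k' [At' ->]]]|_ [t [k [At ->]]] tkS].
    exists (a *: t + t'), (a * k + k'); split; first exact: Alin.
    by rewrite scalerDr scalerA addrACA scalerDl.
  have [k0|k0] := eqVneq k 0.
    by move: tkS; rewrite k0 scale0r addr0 => /A0S ->.
  case: nv; exists (k^-1 *: (t + k *: v)); split; first exact: rpredZ.
  rewrite scalerDr scalerA mulVf// scale1r opprD addrCA subrr addr0 -scaleNr.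
  exact: AZ.
have [p pP] := choice dec.
have uniq v s : s \in S -> A (v - s) -> p v = s.
  move=> sS As; have [pS Ap] := pP v; apply/eqP; rewrite -subr_eq0; apply/eqP.
  apply: A0S; last by rewrite -scaleN1r rpredD ?rpredZ.
  have := Alin (-1) _ _ Ap As; rewrite scaleN1r opprB.
  by rewrite addrA subrK.
have plin : linear p.
  move=> a u v; apply: uniq.
    by rewrite rpredD ?rpredZ ?(pP _).1.
  by rewrite opprD addrACA -scalerBr; apply: Alin; exact: (pP _).2.
pose P : {linear V -> V} := HB.pack p (GRing.isLinear.Build _ _ _ _ p plin).
exists P; split=> [v|s sS]; first exact: (pP v).1.
by apply: uniq => //; rewrite subrr.
Qed.

End LinearExtension.

(** * Evaluating invariant quasimorphisms on mixed chains *)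

Section Evaluation.
Variables (R : realType) (G : groupType) (N : groupClosed G).
Variable N_normal : is_normal N.
Local Notation Nt := (subgrp N).
Local Notation conjN := (conjN N_normal).
Implicit Types (mu nu : QG R N) (m : mixed_chain N R).

Lemma fglift_sum (f : Nt -> R^o) (c : {freeg Nt / R}) :
  fglift f c = \sum_(x <- dom c) coeff x c * f x.
Proof.
rewrite -{1}[c]freeg_sumE linear_sum; apply: eq_bigr => x _.
exact: liftU.
Qed.

Lemma eval_chainP mu a m m' :
  eval_chain mu (a *: m + m') = a * eval_chain mu m + eval_chain mu m'.
Proof. by rewrite /eval_chain [X in fglift _ X]linearP linearP. Qed.

Lemma eval_chainB mu m m' :
  eval_chain mu (m - m') = eval_chain mu m - eval_chain mu m'.
Proof. by rewrite /eval_chain [X in fglift _ X]linearB linearB. Qed.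

Lemma eval_chainDl a mu nu m :
  eval_chain (a *: mu + nu) m = a * eval_chain mu m + eval_chain nu m.
Proof.
rewrite /eval_chain !fglift_sum mulr_sumr -big_split; apply: eq_bigr => x _ /=.
by rewrite /QG_fun linearP /= mulrDr mulrCA.
Qed.

Lemma QG_invariant mu : is_invariant (QG_fun mu).
Proof. by have /asboolP[] := valP mu. Qed.

Lemma QG_homogeneous mu : is_homogeneous (QG_fun mu).
Proof. by have /asboolP[] := valP mu. Qed.

Lemma QG_zpow mu x k : QG_fun mu (zpow x k) = k%:~R * QG_fun mu x.
Proof.
pose f (j : int) : R := QG_fun mu (zpow x j).
have fD i j : f (i + j) = f i + f j by rewrite /f zpowD QG_homogeneous.
have f0 : f 0 = 0 by apply: (addIr (f 0)); rewrite -fD addr0 add0r.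
have fn (n : nat) : f n%:Z = n%:R * f 1.
  elim: n => [|n IHn]; first by rewrite f0 mul0r.
  by rewrite -addn1 PoszD fD IHn natrD mulrDl mul1r.
rewrite -/(f k) -[QG_fun mu x]/(f 1); case: k => n; first exact: fn.
rewrite NegzE rmorphN mulNr -fn; apply: (addrI (f n.+1%:Z)).
by rewrite -fD !subrr.
Qed.

Lemma eval_chain_le_norm mu m :
  `|eval_chain mu m| <= defect (QG_fun mu) * `|m|.
Proof.
set D := defect _; have D0 : 0 <= D := defect_ge0 (QG_quasimorphism mu).
have [phi [phi_incl phiMl phiMr]] := normal_retraction N_normal.
(* The divisor is [D + 1] because [D] may be 0. *)
apply/ler_addgt0Pr => e e0; have D1 : 0 < D + 1 by rewrite ltr_wpDl.
have [c' [Cc' bc'] ce] := mixed_norm_approx m (divr_gt0 e0 D1).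
have h : `|eval_chain mu m| <= D * l1norm c'.
  rewrite /eval_chain (filling_triangles phi_incl bc') linear_sum mulr_sumr.
  rewrite big_seq [leRHS]big_seq (le_trans (ler_norm_sum _ _ _))//.
  apply: ler_sum => p pc; rewrite linearZ /= normrM mulrC ler_wpM2r//.
  have [g [x [y ->]]] := triangle_conj R phi_incl phiMl phiMr (C2'_dom Cc' pc).
  rewrite linearD linearB /= !liftU !scale1r.
  rewrite (QG_invariant mu (incl_conjN N_normal g y)).
  have := le_defect x y (QG_quasimorphism mu).
  by rewrite -normrN !opprB addrA addrAC.
rewrite (le_trans h)// (le_trans (ler_wpM2l D0 (ltW ce)))//.
rewrite mulrDr lerD2l// mulrCA ler_piMr ?(ltW e0)// ler_pdivrMr// mul1r.
by rewrite lerDl.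
Qed.

Lemma eval_chain_h mu m : m \in @h_pred R G N -> eval_chain mu m = 0.
Proof.
move=> /asboolP[s sh]; rewrite /eval_chain => ->; rewrite linear_sum big_seq.
rewrite big1// => p /sh[x [k ->]]; rewrite linearZ linearB linearZ /= !liftU.
by rewrite !scale1r QG_zpow subrr scaler0.
Qed.

(** Evaluation is continuous for the norm and vanishes on h(G, N), hence on its closure. *)
Lemma eval_chain_class mu m m' : Ch_class m = Ch_class m' ->
  eval_chain mu m = eval_chain mu m'.
Proof.
move=> /Ch_class_eqP mm'; apply/eqP; rewrite -subr_eq0 -eval_chainB -normr_eq0.
rewrite eq_le normr_ge0 andbT; apply/ler_addgt0Pr => e e0; rewrite add0r.
set D := defect (QG_fun mu).
have D0 : 0 <= D := defect_ge0 (QG_quasimorphism mu).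
have D1 : 0 < D + 1 by rewrite ltr_wpDl.
have [h hh he] := mm' _ (divr_gt0 e0 D1).
rewrite -[eval_chain _ _]subr0 -(eval_chain_h mu hh) -eval_chainB.
rewrite (le_trans (eval_chain_le_norm _ _))// (le_trans (ler_wpM2l D0 (ltW he)))//.
by rewrite mulrCA ler_piMr ?(ltW e0)// ler_pdivrMr// mul1r lerDl.
Qed.

Lemma eval_chain_le mu m :
  `|eval_chain mu m| <= defect (QG_fun mu) * `|Ch_class m|.
Proof.
set D := defect _; have D0 : 0 <= D := defect_ge0 (QG_quasimorphism mu).
have D1 : 0 < D + 1 by rewrite ltr_wpDl.
apply/ler_addgt0Pr => e e0.
have [m' mm' me] := Ch_norm_approx (Ch_class m) (divr_gt0 e0 D1).
rewrite -(eval_chain_class mu mm') (le_trans (eval_chain_le_norm _ _))//.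
rewrite (le_trans (ler_wpM2l D0 (ltW me)))// mulrDr lerD2l mulrCA.
by rewrite ler_piMr ?(ltW e0)// ler_pdivrMr// mul1r lerDl.
Qed.

(** The difference is a homomorphism, so its defect 0 bounds its values on mixed chains. *)
Lemma eval_chain_QG_class mu nu m : QG_class mu = QG_class nu ->
  eval_chain mu m = eval_chain nu m.
Proof.
move=> /quotpi_eqP/asboolP mn; have [q d0] := is_hom_quasimorphism mn.
have := eval_chain_le (mu - nu) m.
have -> : mu - nu = -1 *: nu + mu by rewrite scaleN1r addrC.
rewrite eval_chainDl mulN1r => h; apply/eqP; rewrite -subr_eq0 -normr_eq0.
rewrite eq_le normr_ge0 andbT addrC (le_trans h)//.
rewrite -[_ *: nu + mu]addrC scaleN1r mulr_le0_ge0//.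
Qed.

(* A functional on [C^h(G, N)] restricts to the basis elements [x] once it is
   extended from [C_R(G, N)] to all chains on [N]. *)
Lemma functional_quasimorphism (f : {linear Ch R N -> R^o}) (K : R) : 0 <= K ->
  (forall q, `|f q| <= K * `|q|) ->
  exists mu : QG R N, forall m, eval_chain mu m = f (Ch_class m).
Proof.
move=> K0 fK; have [p [pS pid]] := linear_projection (mixed_pred N R).
pose P (c : {freeg Nt / R}) : mixed_chain N R := Sub (p c) (pS c).
have Plin a c d : P (a *: c + d) = a *: P c + P d.
  by apply: val_inj; rewrite [RHS]linearP !SubK linearP.
pose F (c : {freeg Nt / R}) : R^o := f (Ch_class (P c)).
have Fval m : F (val m) = f (Ch_class m).
  by congr (f (Ch_class _)); apply: val_inj; rewrite SubK pid//; exact: (valP m).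
have Flin : linear F by move=> a c d; rewrite /F Plin !linearP.
pose Fl : {linear {freeg Nt / R} -> R^o} :=
  HB.pack F (GRing.isLinear.Build _ _ _ _ F Flin).
have FP c r : ch_le c r -> `|Fl c| <= K * r.
  move=> [m <- mr]; rewrite [Fl _]Fval (le_trans (fK _))//.
  by rewrite ler_wpM2l.
pose mu (x : Nt) : R^o := Fl << x >>.
have mu_pow x k : mu (zpow x k) = k%:~R * mu x.
  have := FP _ _ (ch_le_power R x k); rewrite mulr0 normr_le0.
  by rewrite linearB linearZ subr_eq0 => /eqP.
(* [ch_le_mul] bounds the defect by [K]; homogeneity and invariance hold exactly because the
   corresponding relations have norm zero. *)
have muQG : mu \in @QG_pred R G N.
  apply/asboolP; split.
  - apply: (proj1 (defect_le (M := K) _)) => x y.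
    have := FP _ _ (ch_le_mul R x y); rewrite mulr1 linearD linearB /= -/(mu _).
    rewrite -normrN -/(mu (x * y)%g) -/(mu y); congr (`|_| <= _).
    by rewrite /mu; ring.
  - by move=> x i j; rewrite -zpowD !mu_pow rmorphD mulrDl.
  - move=> g x y yx; have -> : y = conjN g x.
      by apply: incl_inj; rewrite incl_conjN.
    have := FP _ _ (ch_le_conj R N_normal g x); rewrite mulr0 normr_le0.
    by rewrite linearB subr_eq0 => /eqP.
exists (Sub mu muQG) => m; rewrite -Fval /eval_chain.
have -> : QG_fun (Sub mu muQG) = mu by rewrite /QG_fun SubK.
rewrite fglift_sum -[F _]/(Fl _) -[in RHS](freeg_sumE (val m)) linear_sum.
apply: eq_bigr => x _; rewrite -[coeff x _ in RHS]mulr1 -freegUZ linearZ //.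
Qed.

End Evaluation.

(** * Continuity and dense subsets *)

Section Continuity.
Variables (R : realType) (V : normedModType R).

Lemma lipschitz_continuous (f : V -> R^o) (k : R) : 0 <= k ->
  (forall x y, `|f x - f y| <= k * `|x - y|) -> continuous f.
Proof.
move=> k0 fk x; apply/(@cvgrPdist_le R R^o) => e e0; apply/nbhs_normP.
have k1 : 0 < k + 1 by rewrite ltr_wpDl.
exists (e / (k + 1)) => /=; first by rewrite divr_gt0.
move=> y /= /ltW xy; rewrite (le_trans (fk _ _))// (le_trans (ler_wpM2l k0 xy))//.
by rewrite mulrCA ler_piMr ?(ltW e0)// ler_pdivrMr// mul1r lerDl.
Qed.

Lemma continuous_eq_dense (S : set V) (f g : V -> R) :
  continuous f -> continuous g ->
  (forall q e, 0 < e -> exists2 s, S s & `|q - s| <= e) ->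
  (forall s, S s -> f s = g s) -> f = g.
Proof.
move=> cf cg Sd fg; apply/funext => q; apply/eqP; rewrite -subr_eq0 -normr_eq0.
rewrite eq_le normr_ge0 andbT; apply/ler_addgt0Pr => e e0; rewrite add0r.
have e2 : 0 < e / 2 by rewrite divr_gt0.
have : \forall s \near q, `|f q - f s| <= e / 2.
  exact: (@cvgrPdist_le R R^o _ _ _ f (f q)).1 (cf q) _ e2.
move=> /nbhs_normP[d1 /= d10 fd].
have : \forall s \near q, `|g q - g s| <= e / 2.
  exact: (@cvgrPdist_le R R^o _ _ _ g (g q)).1 (cg q) _ e2.
move=> /nbhs_normP[d2 /= d20 gd].
have d0 : 0 < Num.min d1 d2 by rewrite lt_min d10.
have [s Ss qs] := Sd q _ (divr_gt0 d0 (ltr0n R 2)).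
have {}qs : `|q - s| < Num.min d1 d2.
  by rewrite (le_lt_trans qs)// ltr_pdivrMr// ltr_pMr// ltr1n.
have := fd s (lt_le_trans qs _); rewrite ge_min lexx => /(_ isT) fqs.
have := gd s (lt_le_trans qs _); rewrite ge_min lexx orbT => /(_ isT) gqs.
rewrite (_ : f q - g q = (f q - f s) - (g q - g s)); last first.
  by rewrite (fg s Ss); ring.
by rewrite (le_trans (ler_normB _ _))// [e]splitr lerD.
Qed.

End Continuity.

(** * The duality pairing *)

Section Duality.
Variables (R : realType) (G : groupType) (N : groupClosed G).
Variable N_normal : is_normal N.
Local Notation Nt := (subgrp N).
Variable p : norm_on (Ch R N).
Hypothesis pE : forall q, p q = 2^-1 * `|q|.
Local Notation X := (normed_by p).
Local Notation Y := (normed_by (twice_defect_norm R N)).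

(** Evaluates chosen representatives; [pairing_evaluation] shows that the choice does not matter. *)
Definition pairing (y : QG_mod_H1G R N) (x : Ch R N) : R :=
  eval_chain (quotrep y) (quotrep x).

Lemma pairing_evaluation : is_evaluation_pairing pairing.
Proof.
move=> mu c; rewrite /pairing (@eval_chain_class _ _ _ N_normal _ _ c).
  by apply: (eval_chain_QG_class N_normal); exact: quotrepK.
exact: (quotrepK (S := closurep (@h_pred R G N))).
Qed.

Lemma pairing_linearr y : linear (pairing y : X -> R^o).
Proof.
move=> a x x'; have [m <-] := Ch_class_surj (x : Ch R N).
have [m' <-] := Ch_class_surj (x' : Ch R N).
rewrite -[y]quotrepK -/(QG_class _) !pairing_evaluation -eval_chainP.
by rewrite -pairing_evaluation linearP.
Qed.

Lemma pairing_linearl a y y' x :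
  pairing (a *: y + y') x = a * pairing y x + pairing y' x.
Proof.
have [m <-] := Ch_class_surj x.
rewrite -[y]quotrepK -[y']quotrepK -linearP -!/(QG_class _) !pairing_evaluation.
exact: eval_chainDl.
Qed.

Lemma pairing_le (y : Y) (x : X) : `|pairing y x| <= `|y| * `|x|.
Proof.
rewrite [`|x|]pE; have [m <-] := Ch_class_surj (x : Ch R N).
rewrite [`|y|]/(twice_defect _) mulrCA mulrA -/(2^-1 * _).
rewrite -[y in leLHS]quotrepK -/(QG_class _) pairing_evaluation.
rewrite (le_trans (eval_chain_le N_normal _ _))// /twice_defect.
by rewrite !mulrA mulVf// mul1r.
Qed.

Lemma pairing_dual_pred (y : Y) : (pairing y : X -> R^o) \in @dual_pred R X.
Proof.
apply/asboolP; split; first exact: pairing_linearr.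
apply: (@lipschitz_continuous R X _ `|y|) => // x x'.
apply: le_trans (pairing_le y (x - x')).
pose g : X -> R^o := pairing y.
have gl : linear g := pairing_linearr y.
pose f : {linear X -> R^o} := HB.pack g (GRing.isLinear.Build _ _ _ _ g gl).
by rewrite -[pairing y x]/(f x) -[pairing y x']/(f x') -linearB.
Qed.

Definition pairing_dual (y : Y) : dual X :=
  exist _ (pairing y : X -> R^o) (pairing_dual_pred y).

Lemma pairing_dual_linear : linear pairing_dual.
Proof.
by move=> a y y'; apply: val_inj; apply/funext => x; exact: pairing_linearl.
Qed.

Lemma pairing_dual_norm y : `|pairing_dual y| = `|y|.
Proof.
apply/eqP; rewrite eq_le; apply/andP; split.
  apply: ge_sup; first exact: (dual_norm_has_sup _).1.
  move=> _ [x /= x1 <-]; rewrite (le_trans (pairing_le y x))//.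
  by rewrite ler_piMr.
rewrite -[y in leLHS]quotrepK [leLHS]twice_defect_class mulrC -ler_pdivlMr//.
set mu := quotrep y.
apply: (proj2 (defect_le (M := `|pairing_dual y| / 2) _)) => u v.
have [m mE m1] := ch_le_mul R u v.
(* For the norm [p] the class of [2 (u - u v + v)] lies in the unit ball, and there [mu] takes, up
   to sign, twice the value that enters the defect. *)
have p1 : `|(2 *: Ch_class m : X)| <= 1.
  by rewrite [`|_|]pE normrZ normr_nat mulrA mulVf// mul1r.
have := dual_norm_ub (pairing_dual y) p1.
rewrite linearZ normrZ normr_nat [X in 2 * `|X|](_ : _ = eval_chain mu m).
  rewrite ler_pdivlMr// mulrC; congr (_ * _ <= _).
  rewrite /eval_chain mE linearD linearB /= !liftU !scale1r.
  by rewrite -[RHS]normrN !opprB addrC.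
transitivity (pairing (QG_class mu) (Ch_class m)); last exact: pairing_evaluation.
by rewrite /QG_class quotrepK.
Qed.

Lemma pairing_dual_surj (f : dual X) : exists y, pairing_dual y = f.
Proof.
pose g : Ch R N -> R^o := dual_fun f.
have gl : linear g := dual_linear f.
pose h : {linear Ch R N -> R^o} := HB.pack g (GRing.isLinear.Build _ _ _ _ g gl).
(* The factor 1/2 passes from the norm [p] to the quotient norm. *)
have K0 : 0 <= dual_norm f * 2^-1 by rewrite mulr_ge0// dual_norm_ge0.
have hK q : `|h q| <= dual_norm f * 2^-1 * `|q|.
  have [->|q0] := eqVneq q 0; first by rewrite linear0 !normr0 mulr0.
  pose r : R := `|(q : X)|; have rE : r = 2^-1 * `|q| by exact: pE.
  have r0 : 0 < r by rewrite rE mulr_gt0// normr_gt0.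
  have := @dual_norm_ub _ _ f (r^-1 *: (q : X)).
  rewrite normrZ normfV gtr0_norm// mulVf ?gt_eqF// => /(_ (lexx _)).
  rewrite linearZ normrZ normfV gtr0_norm// ler_pdivrMl// -mulrA -rE.
  by rewrite mulrC.
have [mu muE] := functional_quasimorphism N_normal K0 hK.
exists (QG_class mu); apply: val_inj; apply/funext => x.
have [m mx] := Ch_class_surj (x : Ch R N).
rewrite -[LHS]/(pairing (QG_class mu) x) -mx pairing_evaluation muE.
by rewrite mx.
Qed.

Lemma pairing_is_duality : @is_duality_pairing R Y X pairing.
Proof.
pose T : {linear Y -> dual X} :=
  HB.pack pairing_dual (GRing.isLinear.Build _ _ _ _ _ pairing_dual_linear).
exists T; split=> //; [exact: pairing_dual_norm|exact: pairing_dual_surj].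
Qed.

Lemma dual_isometric_QG : isometrically_isomorphic (dual X) Y.
Proof.
have inj : injective pairing_dual.
  move=> y y' yy'; apply/eqP; rewrite -subr_eq0 -normr_eq0 -pairing_dual_norm.
  have -> : pairing_dual (y - y') = pairing_dual y - pairing_dual y'.
    by rewrite -scaleN1r addrC pairing_dual_linear scaleN1r addrC.
  by rewrite yy' subrr normr0.
have [T TK] := choice pairing_dual_surj.
have KT : cancel pairing_dual T by move=> y; apply: inj; exact: TK.
have Tlin : linear T.
  by move=> a f g; apply: inj; rewrite pairing_dual_linear !TK.
exists (HB.pack T (GRing.isLinear.Build _ _ _ _ T Tlin) : {linear dual X -> Y}).
  by exists pairing_dual.
by move=> f; rewrite -pairing_dual_norm /= TK.
Qed.

End Duality.

Lemma half_norm_continuous (R : realType) (V : normedModType R) :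
  continuous (fun q : V => 2^-1 * `|q| : R).
Proof.
apply: (@lipschitz_continuous R V _ 2^-1) => // x y.
by rewrite -mulrBr normrM ger0_norm// ler_wpM2l// ler_dist_dist.
Qed.

(** * Half a norm as a norm, and the theorem *)

Section HalfNorm.
Variables (R : realType) (V : normedModType R).

Lemma half_normD (u v : V) : 2^-1 * `|u + v| <= 2^-1 * `|u| + 2^-1 * `|v| :> R.
Proof. by rewrite -mulrDr ler_wpM2l// ler_normD. Qed.

Lemma half_normZ (a : R) (v : V) : 2^-1 * `|a *: v| = `|a| * (2^-1 * `|v|) :> R.
Proof. by rewrite normrZ mulrCA. Qed.

Lemma half_norm0 (v : V) : 2^-1 * `|v| = 0 :> R -> v = 0.
Proof.
by move=> /eqP; rewrite mulf_eq0 invr_eq0 pnatr_eq0 /= normr_eq0 => /eqP.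
Qed.

End HalfNorm.

Theorem theorem4p6 (R : realType) (G : groupType) (N : groupClosed G)
    (N_normal : is_normal N) :
  (forall c : mixed_chain N rat, scl R c = 2^-1 * `|ChQ_class R c|) /\
  (exists! F : Ch R N -> R, is_scl_extension F) /\
  (forall F : Ch R N -> R, is_scl_extension F ->
     exists2 p : norm_on (Ch R N), (forall q, p q = F q) &
       (exists2 B : QG_mod_H1G R N -> Ch R N -> R,
          is_evaluation_pairing B &
          @is_duality_pairing R (normed_by (twice_defect_norm R N))
            (normed_by p) B) /\
       isometrically_isomorphic (dual (normed_by p))
         (normed_by (twice_defect_norm R N))).
Proof.
have scl_half (c : mixed_chain N rat) := scl_half_norm R N_normal c.
have ext : is_scl_extension (fun q : Ch R N => 2^-1 * `|q|).
  split=> [q||c]; [by rewrite mulr_ge0|exact: half_norm_continuous|].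
  by rewrite scl_half.
(* Density of the rational classes leaves no other continuous extension, so the remaining claims
   concern half the quotient norm alone. *)
have ext_unique F : is_scl_extension F -> (fun q : Ch R N => 2^-1 * `|q|) = F.
  move=> [_ cF FQ]; apply: (continuous_eq_dense (S := range (@ChQ_class R G N))).
  - exact: half_norm_continuous.
  - exact: cF.
  - move=> q e e0; have [c qc] := ChQ_dense q e0.
    by exists (ChQ_class R c) => //; exists c.
  - by move=> _ [c _ <-]; rewrite FQ scl_half.
split; first exact: scl_half; split.
  by exists (fun q : Ch R N => 2^-1 * `|q|); split.
move=> F /ext_unique <-.
pose p : norm_on (Ch R N) := NormOn (@half_normD R (Ch R N))
  (@half_normZ R (Ch R N)) (@half_norm0 R (Ch R N)).
exists p => //; split.
  exists (@pairing R G N); first exact: pairing_evaluation.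
  exact: (pairing_is_duality N_normal).
exact: (dual_isometric_QG N_normal).
Qed.
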